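(* Let $\mathcal P=\{\mathbb P_X\mathbb P_{Y\mid X}:\mathbb P_X\in\mathcal P_X,\ \mathbb P_{Y\mid X}\in\mathcal P_{Y\mid X}\}$, $\mathbb P^*=\mathbb P_X^*\mathbb P_{Y\mid X}^*\in\mathcal P$, and let $\theta:\mathcal P\to\Theta\subseteq\mathbb R^p$ have efficient influence function $\varphi^*_{\eta^*}(z)$ at $\mathbb P^*$ relative to $\mathcal P$, where $\eta:\mathcal P\to\Omega$ is a functional into a metric space $(\Omega,\rho)$ and $\eta^*=\eta(\mathbb P^* )$. Suppose that $\theta(\cdot)$ is well-specified at $\mathbb P^*_{Y\mid X}$ relative to $\mathcal P_X$. Then the semiparametric efficiency lower bound for $\theta(\cdot)$ at $\mathbb P^*$ relative to $\mathcal P$ is the same as the semiparametric efficiency lower bound for $\theta(\cdot)$ at $\mathbb P^*$ relative to the reduced model $\{\mathbb P_X^*\}\otimes\mathcal P_{Y\mid X}=\{\mathbb P_X^*\mathbb P_{Y\mid X}:\mathbb P_{Y\mid X}\in\mathcal P_{Y\mid X}\}$.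
   Context: $Z=(X,Y)\in\mathcal X\times\mathcal Y$, $Z\sim\mathbb P^*=\mathbb P^*_X\mathbb P^*_{Y\mid X}$. All models are dominated by a common measure; $\mathbb P^*_X\in\mathcal P_X$, $\mathbb P^*_{Y\mid X}\in\mathcal P_{Y\mid X}$. $\mathcal L^2_{p,0}(\mathbb P)$: square-integrable mean-zero $\mathbb R^p$-valued functions under $\mathbb P$. Well-specification: $\theta(\cdot)$ is well-specified at $\mathbb P_{Y\mid X}^*$ relative to $\mathcal P_X$ if $\theta(\mathbb P_X^*\mathbb P^*_{Y\mid X})=\theta(\mathbb P_X\mathbb P^*_{Y\mid X})$ for every $\mathbb P_X\in\mathcal P_X$. For a model $\mathcal M$ containing $\mathbb P^*$: a one-dimensional regular parametric sub-model is a family $\{\mathbb P_t:t\in T\subset\mathbb R\}\subset\mathcal M$ with $\mathbb P_{t^*}=\mathbb P^*$, differentiable in quadratic mean at $t^*$, with score $s_{t^*}\in\mathcal L^2_{1,0}(\mathbb P^* )$; the tangent space $\mathcal T_{\mathcal M}(\mathbb P^* )$ is the closed linear span of all such scores. $D\in\mathcal L^2_{p,0}(\mathbb P^* )$ is a gradient of $\theta$ at $\mathbb P^*$ relative to $\mathcal M$ if $\frac{d}{dt}\theta(\mathbb P_t)|_{t=t^*}=\mathbb E[D(Z)s_{t^*}(Z)]$ for every such sub-model; it is the efficient influence function if moreover $a^\top D\in\mathcal T_{\mathcal M}(\mathbb P^* )$ for all $a\in\mathbb R^p$. The semiparametric efficiency lower bound relative to $\mathcal M$ is the variance matrix under $\mathbb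 P^*$ of the efficient influence function relative to $\mathcal M$. *)

(* Defs.v *)
From HB Require Import structures.
From mathcomp Require Import all_boot all_order all_algebra.
From mathcomp Require Import all_classical all_reals all_analysis.
From mathcomp Require Import measurable_realfun.

Set Implicit Arguments.
Unset Strict Implicit.
Unset Printing Implicit Defensive.

Import Order.TTheory GRing.Theory Num.Theory.
Import numFieldNormedType.Exports.

Local Open Scope classical_set_scope.
Local Open Scope ring_scope.

Section joint.
Context (dX dY : measure_display) (X : measurableType dX) (Y : measurableType dY)
  (R : realType) (P : probability X R) (K : R.-pker X ~> Y).
Local Open Scope ereal_scope.

(* P(dx) K(x, dy) *)
Definition joint (A : set (X * Y)) : \bar R := \int[P]_x K x (xsection A x).

Let measurable_joint_section A : measurable A ->
  measurable_fun [set: X] (fun x => K x (xsection A x)).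
Proof.
by move=> mA; apply: measurable_fun_xsection_finite_kernel; rewrite inE.
Qed.

Let joint0 : joint set0 = 0.
Proof. by apply: integral0_eq => x _; rewrite xsection0 measure0. Qed.

Let joint_ge0 A : 0 <= joint A.
Proof. exact: integral_ge0. Qed.

Let joint_sigma_additive : semi_sigma_additive joint.
Proof.
move=> F mF tF mUF.
rewrite [X in X @ _ --> _](_ : _ = fun n =>
    \int[P]_x \sum_(0 <= i < n) K x (xsection (F i) x)); last first.
  apply/funext => n; rewrite ge0_integral_sum//.
  by move=> i; exact: measurable_joint_section.
have -> : joint (\bigcup_n F n) =
    \int[P]_x limn (fun n => \sum_(0 <= i < n) K x (xsection (F i) x)).
  apply: eq_integral => x _; rewrite xsection_bigcup.
  rewrite measure_semi_bigcup//.
  - by move=> i; exact: measurable_xsection.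
  - exact: trivIset_xsection.
  - by apply: bigcupT_measurable => i; exact: measurable_xsection.
apply: cvg_monotone_convergence => //.
- move=> n; apply: emeasurable_sum => i; exact: measurable_joint_section.
- by move=> n x _; exact: sume_ge0.
- by move=> x _ m n mn; exact: lee_sum_nneg_natr.
Qed.

HB.instance Definition _ := isMeasure.Build _ _ _ joint
  joint0 joint_ge0 joint_sigma_additive.

Let joint_setT : joint setT = 1.
Proof.
rewrite /joint; under eq_integral do rewrite xsectionE preimage_setT prob_kernel.
rewrite integral_cst// mul1e.
exact: probability_setT.
Qed.

HB.instance Definition _ := Measure_isProbability.Build _ _ _ joint joint_setT.

End joint.

Section semiparametric_model.
Context (dX dY : measure_display) (X : measurableType dX) (Y : measurableType dY)
  (R : realType).

Definition product_model (PX : set (probability X R))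
    (PYX : set (R.-pker X ~> Y)) : set (probability (X * Y)%type R) :=
  [set P | exists Q K,
    [/\ PX Q, PYX K & P = joint Q K :> probability (X * Y)%type R]].

Definition well_specified (V : Type) (theta : probability (X * Y)%type R -> V)
    (PX : set (probability X R)) (Q0 : probability X R)
    (K0 : R.-pker X ~> Y) : Prop :=
  forall Q, PX Q -> theta (joint Q0 K0) = theta (joint Q K0).

End semiparametric_model.

Section efficiency.
Context (d : measure_display) (Z : measurableType d) (R : realType).
Implicit Types (P : probability Z R) (M : set (probability Z R)) (s g : Z -> R).

Definition L20 P s : Prop := s \in Lfun P 2%:E /\ 'E_P[s]%E = 0%E.

Definition sqrt_density (nu : {sigma_finite_measure set Z -> \bar R}) P
    (z : Z) : R :=
  Num.sqrt (fine (Radon_Nikodym (charge_of_finite_measure P) nu z)).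

(* The squared L2(nu) remainder of the expansion
   sqrt p_t = sqrt p_t0 + (t - t0) / 2 * s * sqrt p_t0 is o((t - t0)^2). *)
Definition differentiable_in_quadratic_mean
    (nu : {sigma_finite_measure set Z -> \bar R})
    (Pt : R -> probability Z R) (t0 : R) s : Prop :=
  (((t - t0) ^- 2)%:E * \int[nu]_z
    ((sqrt_density nu (Pt t) z - sqrt_density nu (Pt t0) z
      - (t - t0) / 2 * s z * sqrt_density nu (Pt t0) z) ^+ 2)%:E)%E
    @[t --> t0^'] --> 0%E.

(* Only the values of Pt on T matter; t0 is interior to T, so that the score is
   determined by the sub-model and d/dt is a two-sided derivative. *)
Definition regular_submodel (nu : {sigma_finite_measure set Z -> \bar R}) M
    P (T : set R) (t0 : R) (Pt : R -> probability Z R) s : Prop :=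
  [/\ nbhs t0 T, forall t, T t -> M (Pt t), Pt t0 = P, L20 P s
    & differentiable_in_quadratic_mean nu Pt t0 s].

Definition score (nu : {sigma_finite_measure set Z -> \bar R}) M P :
    set (Z -> R) :=
  [set s | exists T t0 Pt, regular_submodel nu M P T t0 Pt s].

Definition closed_linear_span P (S : set (Z -> R)) : set (Z -> R) :=
  [set g | g \in Lfun P 2%:E /\
    forall e : R, 0 < e -> exists n (c : 'I_n -> R) (s : 'I_n -> Z -> R),
      (forall i, S (s i)) /\
      ('N[P]_2%:E [EFin \o (fun z => g z - \sum_(i < n) c i * s i z)%R]
        < e%:E)%E].

Definition tangent_space (nu : {sigma_finite_measure set Z -> \bar R}) M P :
    set (Z -> R) :=
  closed_linear_span P (score nu M P).

Variable p : nat.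
Implicit Types (theta : probability Z R -> 'cV[R]_p) (D : Z -> 'cV[R]_p).

Definition gradient (nu : {sigma_finite_measure set Z -> \bar R}) M theta P
    D : Prop :=
  (forall i, L20 P (fun z => D z i 0)) /\
  forall T t0 Pt s, regular_submodel nu M P T t0 Pt s ->
    is_derive t0 (1 : R) (fun t : R => theta (Pt t))
      (\col_i fine 'E_P[fun z => D z i 0 * s z]).

Definition efficient_influence_function
    (nu : {sigma_finite_measure set Z -> \bar R}) M theta P D : Prop :=
  gradient nu M theta P D /\
  forall a : 'cV[R]_p, tangent_space nu M P (fun z => (a^T *m D z) 0 0).

Definition variance_matrix P D : 'M[R]_p :=
  \matrix_(i, j) fine (covariance P (fun z => D z i 0) (fun z => D z j 0)).

Definition efficiency_lower_bound
    (nu : {sigma_finite_measure set Z -> \bar R}) M theta P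
    (V : 'M[R]_p) : Prop :=
  exists2 D, efficient_influence_function nu M theta P D
           & V = variance_matrix P D.

End efficiency.

(* Main.v *)
(** Write a sub-model through [Q0 K0] with score [s] as [Q_t K_t], and let
    [S x] be the [K0 x]-mean of [s (x, .)]. Then [Q_t K0] is quadratic-mean
    differentiable with score [S], and [Q0 K_t] with score [s - S]. Along
    [Q_t K0], well-specification makes [theta] constant, so the efficient
    influence function [D] is orthogonal to [S]. Hence replacing each score [s] by
    [s - S], which is a score of the reduced model, only improves an
    approximation of [a^T D] in the span of the scores: [D] is also the efficient
    influence function of the reduced model, and the bound is determined by the
    model since gradients agree on the tangent space.

    Differentiability of the two factors comes from a fibrewise comparison of
    Hellinger-type distances. In each fibre the roots of the conditional
    densities are two unit vectors [v] and [v0], and all error terms are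
    controlled by the remainder of [Q_t K_t] and by [1 - <v, v0>], which is small
    on average. *)
Require Import Defs.
From HB Require Import structures.
From mathcomp Require Import all_boot all_order all_algebra finmap.
From mathcomp Require Import all_classical all_reals all_analysis.
From mathcomp Require Import measurable_realfun ring lra.
Import Order.TTheory GRing.Theory Num.Theory.
Import numFieldNormedType.Exports.
Local Open Scope classical_set_scope.
Local Open Scope ring_scope.

Set Implicit Arguments.
Unset Strict Implicit.
Unset Printing Implicit Defensive.

(** * Integration against joint laws, densities *)

(** The dominating measure [nu] is an arbitrary sigma-finite measure on the product: it need not be
    a product nor disintegrate over [X], so densities in [nu] give no access to the fibres. The
    distances involved do not depend on the dominating measure, which is therefore replaced, for
    each [t] separately, by the sum of the four laws pairing Q_t or Q0 with K_t or K0. This sum lies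
    over Q_t + Q0 with fibres K_t x + K0 x, and in it each of the four laws has a density of the
    form q(x) k(x, y), with one factor for the marginal and one for the kernel. The fibre estimates
    leave an error t^2 (1 - <v, v0>) |w|^2, where w is the score times the root of the density at Q0
    K0. Its integral has to be o(t^2), although [s] is unbounded and 1 - <v, v0> is small only on
    average and changes with t. What saves the argument is that this weight stays between 0 and 1
    while s^2 is one fixed integrable function. *)

Section joint_integral.
Context (dX dY : measure_display) (X : measurableType dX) (Y : measurableType dY)
  (R : realType) (Q : probability X R) (K : R.-pker X ~> Y).
Local Open Scope ereal_scope.

Lemma ge0_integral_indic_sum d (T : measurableType d)
    (mu : {measure set T -> \bar R}) n (c : 'I_n -> R) (A : 'I_n -> set T) :
  (forall i, 0 <= c i)%R -> (forall i, measurable (A i)) ->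
  \int[mu]_z (\sum_(i < n) c i * \1_(A i) z)%:E =
  \sum_(i < n) (c i)%:E * mu (A i).
Proof.
move=> c0 mA; under eq_integral do rewrite -sumEFin.
rewrite ge0_integral_sum//; last first.
- by move=> i x _; rewrite lee_fin mulr_ge0.
- by move=> i; apply/measurable_EFinP; apply: measurable_funM.
apply: eq_bigr => i _; under eq_integral do rewrite EFinM.
rewrite ge0_integralZl_EFin//; first by rewrite integral_indic// setIT.
by apply/measurable_EFinP.
Qed.

Lemma measurable_joint_section A : measurable A ->
  measurable_fun [set: X] (fun x => K x (xsection A x)).
Proof.
by move=> mA; apply: measurable_fun_xsection_finite_kernel; rewrite inE.
Qed.

Import HBNNSimple.

Let ge0_integral_joint_nnsfun (f : {nnsfun (X * Y)%type >-> R}) :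
  \int[joint Q K]_z (f z)%:E = \int[Q]_x \int[K x]_y (f (x, y))%:E.
Proof.
pose s := fset_set (range f).
have s0 (i : 'I_(#|` s|)%fset) : (0 <= s`_i)%R.
  have : s`_i \in s by rewrite mem_nth.
  by rewrite in_fset_set// inE => -[z _ <-].
have mf (i : 'I_(#|` s|)%fset) : measurable (f @^-1` [set s`_i]).
  exact: measurable_sfunP.
transitivity (\int[joint Q K]_z
    (\sum_(i < #|` s|%fset) s`_i * \1_(f @^-1` [set s`_i]) z)%:E).
  by apply: eq_integral => z _; rewrite fimfunEord.
rewrite ge0_integral_indic_sum//.
transitivity (\int[Q]_x
    \sum_(i < #|` s|%fset) (s`_i)%:E * K x (xsection (f @^-1` [set s`_i]) x)).
  rewrite ge0_integral_sum//; first last.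
  - by move=> i x _; rewrite mule_ge0// lee_fin.
  - by move=> i; apply: measurable_funeM; exact: measurable_joint_section.
  apply: eq_bigr => i _; rewrite ge0_integralZl_EFin//.
  exact: measurable_joint_section.
apply: eq_integral => x _.
transitivity (\int[K x]_y
    (\sum_(i < #|` s|%fset)
       s`_i * \1_(xsection (f @^-1` [set s`_i]) x) y)%:E); last first.
  apply: eq_integral => y _; rewrite [in RHS]fimfunEord; congr EFin.
  by apply: eq_bigr => i _; rewrite !indicE mem_xsection.
rewrite ge0_integral_indic_sum// => i; exact: measurable_xsection.
Qed.

Lemma ge0_integral_joint (f : X * Y -> \bar R) :
  measurable_fun setT f -> (forall z, 0 <= f z) ->
  \int[joint Q K]_z f z = \int[Q]_x \int[K x]_y f (x, y).
Proof.
move=> mf f0; pose h := nnsfun_approx measurableT mf.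
have cvh z : (h n z)%:E @[n --> \oo] --> f z by exact: cvg_nnsfun_approx.
have ndh z a b : (a <= b)%N -> (h a z)%:E <= (h b z)%:E.
  by move=> ab; rewrite lee_fin; exact/lefP/nd_nnsfun_approx.
transitivity (\int[joint Q K]_z lim ((h n z)%:E @[n --> \oo])).
  by apply/eq_integral => z _; apply/esym/cvg_lim.
rewrite monotone_convergence//; first last.
- by move=> z _ a b; exact: ndh.
- by move=> n z _; rewrite lee_fin.
- by move=> n; exact/measurable_EFinP.
under eq_fun do rewrite ge0_integral_joint_nnsfun.
have mK n : measurable_fun [set: X] (fun x => \int[K x]_y (h n (x, y))%:E).
  apply: (measurable_fun_integral_finite_kernel (fun z => (h n z)%:E)).
  - by move=> z; rewrite lee_fin.
  - exact/measurable_EFinP.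
have mh n x : measurable_fun [set: Y] (fun y => (h n (x, y))%:E).
  by apply/measurable_EFinP; apply: measurableT_comp.
transitivity (\int[Q]_x lim ((\int[K x]_y (h n (x, y))%:E) @[n --> \oo])).
  rewrite -monotone_convergence//.
  - by move=> n x _; apply: integral_ge0 => y _; rewrite lee_fin.
  - move=> x _ a b ab; apply: ge0_le_integral => // y _.
      by rewrite lee_fin.
    exact: ndh.
apply: eq_integral => x _; rewrite -monotone_convergence//.
- by apply: eq_integral => y _; apply/cvg_lim.
- by move=> n y _; rewrite lee_fin.
- by move=> y _ a b; exact: ndh.
Qed.

End joint_integral.

(** The change of variables formula serves as the definition, so that [mu] and [P] may be any
    measures and densities compose directly. [f] is real and nonnegative at every point, which lets
    square roots of products split without exceptional sets. *)
Definition density d (T : measurableType d) (R : realType)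
    (mu P : {measure set T -> \bar R}) (f : T -> R) :=
  [/\ measurable_fun setT f, forall x, 0 <= f x &
      forall g, measurable_fun setT g -> (forall x, 0 <= g x)%E ->
        (\int[P]_x g x = \int[mu]_x (g x * (f x)%:E))%E].

Section density_theory.
Context d (T : measurableType d) (R : realType).
Local Open Scope ereal_scope.

(** [Radon_Nikodym] is taken of a charge and is nonnegative only almost everywhere. The maximum with
    0 repairs this and leaves [Num.sqrt] unchanged, since that root vanishes on negative numbers. *)
Lemma density_Radon_Nikodym (mu : {sigma_finite_measure set T -> \bar R})
    (P : {finite_measure set T -> \bar R}) : P `<< mu ->
  density mu P
    (fun x => Num.max 0%R (fine (Radon_Nikodym (charge_of_finite_measure P) mu x))).
Proof.
move=> Pmu.
set f := Radon_Nikodym _ _.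
have mf : measurable_fun setT f by exact: measurable_int (Radon_Nikodym_integrable _).
have mf' : measurable_fun setT (fun x => Num.max 0%R (fine (f x))).
  by apply: measurable_maxr => //; exact: measurableT_comp.
split => // [x|g mg g0]; first by rewrite le_max lexx.
rewrite -(@Radon_Nikodym_SigmaFinite.change_of_variables _ _ _ P mu)//.
have mS : measurable_fun setT (Radon_Nikodym_SigmaFinite.f P mu).
  exact: measurable_int (Radon_Nikodym_SigmaFinite.f_integrable _).
apply: ge0_ae_eq_integral => //.
- exact: emeasurable_funM.
- by apply: emeasurable_funM => //; exact/measurable_EFinP.
- by move=> x _; rewrite mule_ge0// Radon_Nikodym_SigmaFinite.f_ge0.
- by move=> x _; rewrite mule_ge0// lee_fin le_max lexx.
apply: ae_eqe_mul2l.
have [N [mN N0 sub]] := ae_eq_Radon_Nikodym_SigmaFinite Pmu measurableT.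
exists N; split => // x /= nx; apply: sub => /= fE; apply: nx => xT.
rewrite (fE xT) -/f EFin_max fineK; last exact: Radon_Nikodym_fin_num.
rewrite max_r// /f -(fE xT).
exact: Radon_Nikodym_SigmaFinite.f_ge0.
Qed.

Lemma density_ae_unique (mu : {measure set T -> \bar R})
    (P : {finite_measure set T -> \bar R}) (f g : T -> R) :
  density mu P f -> density mu P g -> ae_eq mu setT (EFin \o f) (EFin \o g).
Proof.
move=> [mf f0 fP] [mg g0 gP].
have E h A : density mu P h -> measurable A ->
    \int[mu]_(x in A) (h x)%:E = P A.
  move=> [mh h0 hP] mA; rewrite integral_mkcond.
  have : \int[P]_x (\1_A x)%:E = P A by rewrite integral_indic// setIT.
  have mE : measurable_fun setT (fun x => (\1_A x : R)%:E).
    exact/measurable_EFinP.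
  move=> <-; rewrite (hP _ mE)//.
  apply: eq_integral => x _; rewrite patchE indicE.
  by case: ifPn => _; rewrite ?mul1e ?mul0e.
apply: integral_ae_eq => //.
- apply/integrableP; split; first exact/measurable_EFinP.
  under eq_integral do rewrite /= ger0_norm//.
  by rewrite (E f)// ltey_eq fin_num_measure.
- exact/measurable_EFinP.
- by move=> A _ mA; rewrite /= !E.
Qed.

Lemma density_trans (nu mu P : {measure set T -> \bar R}) (f g : T -> R) :
  density nu mu f -> density mu P g -> density nu P (fun x => f x * g x)%R.
Proof.
move=> [mf f0 fP] [mg g0 gP]; split; first exact: measurable_funM.
  by move=> x; rewrite mulr_ge0.
move=> h mh h0; rewrite gP//.
have mhg : measurable_fun setT (fun x => h x * (g x)%:E).
  by apply: emeasurable_funM => //; exact/measurable_EFinP.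
rewrite (fP _ mhg)//; last by move=> x; rewrite mule_ge0// lee_fin.
by apply: eq_integral => x _; rewrite EFinM [(f x)%:E * _]muleC muleA.
Qed.

Lemma density_add (nu P P' : {measure set T -> \bar R}) (f f' : T -> R) :
  density nu P f -> density nu P' f' ->
  density nu (measure_add P P') (fun x => f x + f' x)%R.
Proof.
move=> [mf f0 fP] [mf' f'0 f'P]; split; first exact: measurable_funD.
  by move=> x; rewrite addr_ge0.
move=> g mg g0; rewrite ge0_integral_measure_add// fP// f'P//.
rewrite -ge0_integralD//.
- by apply: eq_integral => x _; rewrite EFinD ge0_muleDr ?lee_fin.
- by move=> x _; rewrite mule_ge0 ?lee_fin.
- by apply: emeasurable_funM => //; exact/measurable_EFinP.
- by move=> x _; rewrite mule_ge0 ?lee_fin.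
- by apply: emeasurable_funM => //; exact/measurable_EFinP.
Qed.

End density_theory.

Section measure_add_finite.
Context d (T : measurableType d) (R : realType).
Variables m1 m2 : {finite_measure set T -> \bar R}.

Let measure_add_fin_num : fin_num_fun (measure_add m1 m2).
Proof.
by move=> A mA; rewrite measure_addE fin_numD !fin_num_measure.
Qed.

HB.instance Definition _ := Measure.on (measure_add m1 m2).

HB.instance Definition _ :=
  Measure_isFinite.Build _ _ _ (measure_add m1 m2) measure_add_fin_num.

Lemma dominates_measure_addl : m1 `<< measure_add m1 m2.
Proof.
apply/null_content_dominatesP => A mA /eqP.
by rewrite [X in X == _]measure_addE padde_eq0// => /andP[/eqP].
Qed.

Lemma dominates_measure_addr : m2 `<< measure_add m1 m2.
Proof.
apply/null_content_dominatesP => A mA /eqP.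
by rewrite [X in X == _]measure_addE padde_eq0// => /andP[_ /eqP].
Qed.

End measure_add_finite.

(** * Hellinger-type distances and the choice of the dominating measure *)

(** With [c] equal to 1 this is the squared Hellinger distance, without a factor 1/2; with [c] equal
    to 1 + (t - t0) / 2 s it is the remainder in differentiability in quadratic mean. *)
Definition hellinger d (T : measurableType d) (R : realType)
    (mu : {measure set T -> \bar R}) (f g c : T -> R) : \bar R :=
  (\int[mu]_x ((Num.sqrt (f x) - c x * Num.sqrt (g x)) ^+ 2)%:E)%E.

Section hellinger.
Context d (T : measurableType d) (R : realType).
Implicit Types (mu nu lam : {measure set T -> \bar R}).
Implicit Types (P : {finite_measure set T -> \bar R}).

Lemma measurable_sqrt_fun (f : T -> R) : measurable_fun setT f ->
  measurable_fun setT (fun x => Num.sqrt (f x)).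
Proof.
by move=> mf; apply: measurableT_comp => //;
exact: (continuous_measurable_fun (@sqrt_continuous R)).
Qed.

Lemma measurable_hellinger (f g c : T -> R) : measurable_fun setT f ->
  measurable_fun setT g -> measurable_fun setT c ->
  measurable_fun setT (fun x => ((Num.sqrt (f x) - c x * Num.sqrt (g x)) ^+ 2)%:E).
Proof.
move=> mf mg mc; apply/measurable_EFinP; apply: measurable_funX.
by apply: measurable_funB; [|apply: measurable_funM => //];
  exact: measurable_sqrt_fun.
Qed.

(** Almost everywhere f = r p and f0 = r p0, so both roots contain the root of [r], and the squared
    difference contains [r], the density of [mu]. *)
Lemma hellinger_density_trans nu mu P P0 (f f0 r p p0 c : T -> R) :
  measurable_fun setT c ->
  density nu P f -> density nu P0 f0 ->
  density nu mu r -> density mu P p -> density mu P0 p0 ->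
  hellinger nu f f0 c = hellinger mu p p0 c.
Proof.
move=> mc fP fP0 rmu pP pP0.
have [mr r0 rE] := rmu; have [mp pp0 _] := pP; have [mp0 p00 _] := pP0.
have [mf f_0 _] := fP; have [mf0 f00 _] := fP0.
rewrite /hellinger rE; last 2 first.
- exact: measurable_hellinger.
- by move=> x; rewrite lee_fin sqr_ge0.
have E1 := density_ae_unique fP (density_trans rmu pP).
have E2 := density_ae_unique fP0 (density_trans rmu pP0).
apply: ge0_ae_eq_integral => //.
- exact: measurable_hellinger.
- by apply: emeasurable_funM; [exact: measurable_hellinger|exact/measurable_EFinP].
- by move=> x _; rewrite lee_fin sqr_ge0.
- by move=> x _; rewrite mule_ge0 ?lee_fin ?sqr_ge0.
apply: filterS2 E1 E2 => x /(_ I) [->] /(_ I) [->] _.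
rewrite !sqrtrM// -EFinM; congr EFin.
have := sqr_sqrtr (r0 x); set s := Num.sqrt (r x) => <-.
by ring.
Qed.

(** [nu] and [lam] need not be comparable. Both distances equal the one taken in [measure_add P P0],
    which has density f + f0 in [nu] and g + g0 in [lam]. *)
Lemma hellinger_indep nu lam P P0 (f f0 g g0 c : T -> R) :
  measurable_fun setT c ->
  density nu P f -> density nu P0 f0 ->
  density lam P g -> density lam P0 g0 ->
  hellinger nu f f0 c = hellinger lam g g0 c.
Proof.
move=> mc fP fP0 gP gP0.
have pP := density_Radon_Nikodym (@dominates_measure_addl _ _ _ P P0).
have pP0 := density_Radon_Nikodym (@dominates_measure_addr _ _ _ P P0).
rewrite (hellinger_density_trans mc fP fP0 (density_add fP fP0) pP pP0).
by rewrite (hellinger_density_trans mc gP gP0 (density_add gP gP0) pP pP0).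
Qed.

End hellinger.

(** * Square-integrable functions *)

Definition square_integrable d (T : measurableType d) (R : realType)
    (mu : {measure set T -> \bar R}) (f : T -> R) :=
  measurable_fun setT f /\ (\int[mu]_x ((f x) ^+ 2)%:E < +oo)%E.

Definition inner d (T : measurableType d) (R : realType)
    (mu : {measure set T -> \bar R}) (f g : T -> R) : R :=
  (\int[mu]_x (f x * g x))%R.

Lemma discriminant_le (R : realType) (a b c : R) :
  (forall t, 0 <= a * t ^+ 2 + 2 * b * t + c) -> b ^+ 2 <= a * c.
Proof.
move=> H; have c0 : 0 <= c by have := H 0; rewrite expr0n/= !mulr0 !add0r.
have [a0|a0|a0] := ltgtP a 0.
(* For a < 0 put u = c / (- a): the values at 1 + u and at - (1 + u) add up to 2 a ((1 + u)^2 - u),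
   which is negative. *)
- have c0a : 0 <= c / - a by rewrite divr_ge0// oppr_ge0 ltW.
  have := H (1 + c / - a); have := H (- (1 + c / - a)).
  have : c = - a * (c / - a) by field; rewrite lt_eqF.
  by move: (c / - a) c0a => u u0 ->; nra.
- have := H (- b / a); have -> : a * (- b / a) ^+ 2 + 2 * b * (- b / a) + c =
      (a * c - b ^+ 2) / a by field; rewrite gt_eqF.
  by rewrite pmulr_lge0 ?invr_gt0// subr_ge0.
- have [->|b0] := eqVneq b 0; first by rewrite expr0n/= a0 mul0r.
  have := H (- (1 + c) / (2 * b)); rewrite a0 mul0r add0r.
  have -> : 2 * b * (- (1 + c) / (2 * b)) + c = -1 by field; rewrite b0.
  by rewrite ler0N1.
Qed.

Section square_integrable.
Context d (T : measurableType d) (R : realType) (mu : {measure set T -> \bar R}).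
Implicit Types (f g h : T -> R) (a : R).
Local Notation sq := (square_integrable mu).
Local Notation ip := (inner mu).

Lemma square_integrableM f g : sq f -> sq g ->
  mu.-integrable setT (EFin \o (fun x => f x * g x)).
Proof.
move=> [mf f2] [mg g2].
have msq h : measurable_fun setT h -> measurable_fun setT (fun x => ((h x) ^+ 2)%:E).
  by move=> mh; apply/measurable_EFinP; exact: measurable_funX.
apply: (@le_integrable _ _ _ mu _ measurableT _ (fun x => ((f x) ^+ 2 + (g x) ^+ 2)%:E)) => //.
- by apply/measurable_EFinP; exact: measurable_funM.
- move=> x _; rewrite lee_fin [leRHS]ger0_norm ?addr_ge0 ?sqr_ge0// ler_norml.
  by apply/andP; split; nra.
- apply/integrableP; split.
    by apply/measurable_EFinP; apply: measurable_funD; exact: measurable_funX.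
  under eq_integral do rewrite gee0_abs ?lee_fin ?addr_ge0 ?sqr_ge0// EFinD.
  rewrite ge0_integralD//; try exact: msq; try by move=> x _; rewrite lee_fin sqr_ge0.
  exact: lte_add_pinfty.
Qed.

Lemma square_integrableZ a f : sq f -> sq (fun x => a * f x).
Proof.
move=> [mf f2]; split; first exact: measurable_funM.
under eq_integral do rewrite exprMn EFinM.
rewrite ge0_integralZl//.
- by rewrite lte_mul_pinfty ?lee_fin ?sqr_ge0.
- by apply/measurable_EFinP; exact: measurable_funX.
- by move=> x _; rewrite lee_fin sqr_ge0.
- by rewrite lee_fin sqr_ge0.
Qed.

Lemma square_integrableD f g : sq f -> sq g -> sq (fun x => f x + g x).
Proof.
move=> sf sg; have [mf f2] := sf; have [mg g2] := sg.
split; first exact: measurable_funD.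
have M u v su sv := @square_integrableM u v su sv.
have i2 := integrableD measurableT
  (integrableD measurableT (M _ _ sf sf) (M _ _ sf sg))
  (integrableD measurableT (M _ _ sg sf) (M _ _ sg sg)).
have /integrableP[_] := i2; apply: le_lt_trans.
apply: ge0_le_integral => //=.
- by move=> x _; rewrite lee_fin sqr_ge0.
- by apply/measurable_EFinP; apply: measurable_funX; exact: measurable_funD.
- apply/measurable_EFinP; apply: measurableT_comp => //.
  by do ?apply: measurable_funD; apply: measurable_funM.
- move=> x _; rewrite lee_fin; apply: le_trans (ler_norm _).
  by rewrite le_eqVlt; apply/orP; left; apply/eqP; ring.
Qed.

Lemma square_integrableB f g : sq f -> sq g -> sq (fun x => f x - g x).
Proof.
move=> sf sg; rewrite (_ : (fun x => _) = fun x => f x + (-1) * g x).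
  by apply: square_integrableD => //; exact: square_integrableZ.
by apply/funext => x; rewrite mulN1r.
Qed.

Lemma innerC f g : ip f g = ip g f.
Proof. by apply: eq_Rintegral => x _; rewrite mulrC. Qed.

Lemma innerDl f g h : sq f -> sq g -> sq h ->
  ip (fun x => f x + g x) h = ip f h + ip g h.
Proof.
move=> sf sg sh; rewrite /inner -RintegralD//; try exact: square_integrableM.
by apply: eq_Rintegral => x _; rewrite mulrDl.
Qed.

Lemma innerZl a f g : sq f -> sq g -> ip (fun x => a * f x) g = a * ip f g.
Proof.
move=> sf sg; rewrite /inner -RintegralZl//; try exact: square_integrableM.
by apply: eq_Rintegral => x _; rewrite mulrA.
Qed.

Lemma innerDr f g h : sq f -> sq g -> sq h ->
  ip h (fun x => f x + g x) = ip h f + ip h g.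
Proof. by move=> *; rewrite innerC innerDl// !(innerC h). Qed.

Lemma innerZr a f g : sq f -> sq g -> ip g (fun x => a * f x) = a * ip g f.
Proof. by move=> *; rewrite innerC innerZl// innerC. Qed.

Lemma innerBl f g h : sq f -> sq g -> sq h ->
  ip (fun x => f x - g x) h = ip f h - ip g h.
Proof.
move=> sf sg sh; rewrite (_ : (fun x => _) = fun x => f x + (-1) * g x).
  by rewrite innerDl ?innerZl ?mulN1r//; exact: square_integrableZ.
by apply/funext => x; rewrite mulN1r.
Qed.

Lemma innerBr f g h : sq f -> sq g -> sq h ->
  ip h (fun x => f x - g x) = ip h f - ip h g.
Proof. by move=> *; rewrite innerC innerBl// !(innerC h). Qed.

Lemma inner_ge0 f : 0 <= ip f f.
Proof. by apply: Rintegral_ge0 => x _; rewrite -expr2 sqr_ge0. Qed.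

Lemma EFin_inner f : sq f -> (ip f f)%:E = (\int[mu]_x ((f x) ^+ 2)%:E)%E.
Proof.
move=> [mf f2]; rewrite /inner /Rintegral; under eq_integral do rewrite -expr2.
rewrite fineK// ge0_fin_numE//; apply: integral_ge0 => x _.
by rewrite lee_fin sqr_ge0.
Qed.

Lemma square_integrable_lin3 (a b c : R) f g h : sq f -> sq g -> sq h ->
  sq (fun x => a * f x + b * g x + c * h x).
Proof.
by move=> *; do ?apply: square_integrableD => //; exact: square_integrableZ.
Qed.

Lemma inner_lin3 (a b c : R) f g h : sq f -> sq g -> sq h ->
  (\int[mu]_x ((a * f x + b * g x + c * h x) ^+ 2)%:E)%E =
  (a ^+ 2 * ip f f + b ^+ 2 * ip g g + c ^+ 2 * ip h h +
   2 * (a * b * ip f g + a * c * ip f h + b * c * ip g h))%:E.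
Proof.
move=> sf sg sh; rewrite -(EFin_inner (square_integrable_lin3 a b c sf sg sh)).
have Z k u : sq u -> sq (fun x => k * u x) by exact: square_integrableZ.
have D u v : sq u -> sq v -> sq (fun x => u x + v x) by exact: square_integrableD.
have Zf := Z a _ sf; have Zg := Z b _ sg; have Zh := Z c _ sh.
have Dfg := D _ _ Zf Zg; have Dfgh := D _ _ Dfg Zh.
congr EFin; rewrite !(innerDl, innerDr, innerZl, innerZr)//.
by rewrite (innerC g f) (innerC h f) (innerC h g); ring.
Qed.

Lemma inner_sqr_le f g : sq f -> sq g -> ip f g ^+ 2 <= ip f f * ip g g.
Proof.
move=> sf sg; apply: discriminant_le => t.
rewrite -lee_fin (_ : (_ + _)%:E = \int[mu]_x ((t * f x + 1 * g x + 0 * g x) ^+ 2)%:E)%E.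
  by apply: integral_ge0 => x _; rewrite lee_fin sqr_ge0.
by rewrite inner_lin3//; congr EFin; ring.
Qed.

End square_integrable.

(** * Hellinger comparison in the fibres *)

(* [Q x y z] stands for [|x v + y v0 + z w|^2], where [v] and [v0] are unit
   vectors, [<v, v0> = b], [<v, w> = g], [<v0, w> = e] and [|w|^2 = n]. *)
Lemma unit_vectors_inequalities (R : realType) (b e g n a a0 t : R)
    (Q : R -> R -> R -> R) :
  (forall x y z, Q x y z = x ^+ 2 + y ^+ 2 + z ^+ 2 * n +
     2 * (x * y * b + x * z * g + y * z * e)) ->
  (forall x y z, 0 <= Q x y z) -> 0 <= b ->
  [/\ b <= 1, a0 ^+ 2 * (1 - b) <= Q a (- a0) 0,
      Q 0 (a - a0 - t * e) 0 <= 30 * Q a (- a0) (- t) + 42 * t ^+ 2 * ((1 - b) * n)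
    & Q a0 (- a0 + t * e) (- t) <=
      30 * Q a (- a0) (- t) + 42 * t ^+ 2 * ((1 - b) * n)].
Proof.
move=> QE Q0 b0.
set dl := 1 - b.
have bE : b = 1 - dl by rewrite /dl; ring.
have dl0 : 0 <= dl by have := Q0 1 (-1) 0; rewrite QE /dl; nra.
have dl1 : dl <= 1 by rewrite /dl lerBlDr lerDl.
have n0 : 0 <= n by have := Q0 0 0 1; rewrite QE; nra.
(* Cauchy-Schwarz for v - v0 and w, as |v - v0|^2 = 2 dl. *)
have CS2 : (g - e) ^+ 2 <= 2 * dl * n.
  apply: discriminant_le => s; have := Q0 s (- s) 1; rewrite QE.
  by move=> h; apply: (le_trans h); rewrite le_eqVlt; apply/orP; left; apply/eqP; rewrite /dl; ring.
have CS3 : e ^+ 2 <= n by have := Q0 0 (- e) 1; rewrite QE; nra.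
set F := Q a (- a0) (- t).
(* [c] is the inner product of the unit vector v with a v - a0 v0 - t w, whose squared length is
   [F]. *)
set c := a - a0 * b - t * g.
have CS1 : c ^+ 2 <= F.
  rewrite -subr_ge0; have := Q0 (a - c) (- a0) (- t); rewrite /F !QE.
  by move=> h; apply: (le_trans h); rewrite le_eqVlt; apply/orP; left; apply/eqP; rewrite /c; ring.
have F0 : 0 <= F by exact: Q0.
(* Here 0 <= b enters: 1 - b^2 = (1 + b) dl is at least dl. *)
have A1 : a0 ^+ 2 * dl <= Q a (- a0) 0.
  rewrite -subr_ge0 QE (_ : _ - _ = (a - a0 * b) ^+ 2 + a0 ^+ 2 * (b * dl)).
    by rewrite addr_ge0 ?sqr_ge0// mulr_ge0 ?sqr_ge0// mulr_ge0.
  by rewrite /dl; ring.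
have A2 : a0 ^+ 2 * dl <= 2 * F + 2 * t ^+ 2 * n.
  apply: (le_trans A1); rewrite -subr_ge0.
  have := Q0 a (- a0) (- 2 * t); rewrite /F !QE.
  by move=> h; apply: (le_trans h); rewrite le_eqVlt; apply/orP; left; apply/eqP; ring.
(* B v0 is the remainder when only the marginal moves. In B = c + t (g - e) - a0 dl the three
   squares are at most F, 2 t^2 dl n and 2 F + 2 t^2 dl n; three times their sum gives the 9 and the
   12. *)
set B := a - a0 - t * e.
have sq3 (x y z : R) : (x + y + z) ^+ 2 <= 3 * (x ^+ 2 + y ^+ 2 + z ^+ 2).
  rewrite -subr_ge0 (_ : _ - _ = (x - y) ^+ 2 + (x - z) ^+ 2 + (y - z) ^+ 2).
    by rewrite !addr_ge0 ?sqr_ge0.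
  by ring.
have t2 : 0 <= t ^+ 2 by exact: sqr_ge0.
have HB : B ^+ 2 <= 9 * F + 12 * t ^+ 2 * (dl * n).
  have -> : B = c + t * (g - e) + - (a0 * dl) by rewrite /B /c /dl; ring.
  apply: (le_trans (sq3 _ _ _)).
  have h1 : (t * (g - e)) ^+ 2 <= t ^+ 2 * (2 * dl * n).
    by rewrite exprMn ler_wpM2l.
  have h2 : (- (a0 * dl)) ^+ 2 <= 2 * F + 2 * t ^+ 2 * (dl * n).
    rewrite sqrrN exprMn [dl ^+ 2]expr2 mulrA.
    apply: (@le_trans _ _ ((2 * F + 2 * t ^+ 2 * n) * dl)); first by rewrite ler_wpM2r.
    rewrite mulrDl lerD//; first by rewrite ler_piMr// mulr_ge0.
    by rewrite le_eqVlt; apply/orP; left; apply/eqP; ring.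
  by lra.
have tn0 : 0 <= t ^+ 2 * (dl * n) by rewrite mulr_ge0// mulr_ge0.
split => //.
- by rewrite bE; lra.
- rewrite -/B QE (_ : _ + _ = B ^+ 2); last by ring.
  by lra.
- have Q3 x y z x' y' z' x'' y'' z'' :
      Q (x + x' + x'') (y + y' + y'') (z + z' + z'') <=
      3 * (Q x y z + Q x' y' z' + Q x'' y'' z'').
    have := Q0 (x - x') (y - y') (z - z').
    have := Q0 (x - x'') (y - y'') (z - z'').
    have := Q0 (x' - x'') (y' - y'') (z' - z'').
    rewrite !QE => p1 p2 p3; rewrite -subr_ge0.
    have := addr_ge0 (addr_ge0 p1 p2) p3.
    by move=> h; apply: (le_trans h); rewrite le_eqVlt; apply/orP; left; apply/eqP; ring.
  (* The remainder when only the kernel moves is the full one minus B v minus t e (v - v0). With |v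
     - v0|^2 = 2 dl and e^2 <= n, the constants become 3 (1 + 9) = 30 and 3 (12 + 2) = 42. *)
  have := Q3 a (- a0) (- t) (- B) 0 0 (- (t * e)) (t * e) 0.
  rewrite -/F !addr0.
  have -> : a + - B + - (t * e) = a0 by rewrite /B; ring.
  move=> h; apply: (le_trans h); rewrite [Q (- B) _ _]QE [Q (- (t * e)) _ _]QE.
  have h4 : t ^+ 2 * e ^+ 2 * dl <= t ^+ 2 * (dl * n).
    by rewrite -mulrA ler_wpM2l// mulrC ler_wpM2l.
  rewrite bE; rewrite -!exprMn in h4 *.
  rewrite (_ : _ + _ + _ = F + B ^+ 2 + 2 * ((t * e) ^+ 2 * dl)); last by ring.
  by lra.
Qed.

(** At one point x of the base, [v] and [v0] are the roots of the conditional densities and [a],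
    [a0] those of the marginal densities. Keeping [a0] inside the square-integrable function and in
    the equation for [S] leaves [S] unconstrained where the reference marginal density vanishes. *)
Lemma fiber_inequality d (T : measurableType d) (R : realType)
    (mu : {measure set T -> \bar R}) (v v0 s : T -> R) (a a0 t S : R) :
  measurable_fun setT v -> measurable_fun setT v0 ->
  (forall y, 0 <= v y) -> (forall y, 0 <= v0 y) ->
  (\int[mu]_y ((v y) ^+ 2)%:E = 1)%E -> (\int[mu]_y ((v0 y) ^+ 2)%:E = 1)%E ->
  square_integrable mu (fun y => a0 * s y * v0 y) ->
  a0 * S = inner mu v0 (fun y => a0 * s y * v0 y) ->
  exists2 b, 0 <= b <= 1 &
  [/\ \int[mu]_y ((v y - v0 y) ^+ 2)%:E = (2 * b)%:E,
      (a0 ^+ 2 * b)%:E <= \int[mu]_y ((a * v y - a0 * v0 y) ^+ 2)%:E,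
      \int[mu]_y ((a * v0 y - (1 + t * S) * (a0 * v0 y)) ^+ 2)%:E <=
        30%:E * \int[mu]_y ((a * v y - (1 + t * s y) * (a0 * v0 y)) ^+ 2)%:E +
        (42 * t ^+ 2)%:E * (b%:E * \int[mu]_y ((a0 * s y * v0 y) ^+ 2)%:E)
    & \int[mu]_y ((a0 * v y - (1 + t * (s y - S)) * (a0 * v0 y)) ^+ 2)%:E <=
        30%:E * \int[mu]_y ((a * v y - (1 + t * s y) * (a0 * v0 y)) ^+ 2)%:E +
        (42 * t ^+ 2)%:E * (b%:E * \int[mu]_y ((a0 * s y * v0 y) ^+ 2)%:E)]%E.
Proof.
move=> mv mv0 v_ge0 v0_ge0 v1 v01 sw.
set w := fun y => _ in sw *; move=> Se.
have sv : square_integrable mu v by split => //; rewrite v1 ltry.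
have sv0 : square_integrable mu v0 by split => //; rewrite v01 ltry.
pose Q x y z := fine (\int[mu]_u ((x * v u + y * v0 u + z * w u) ^+ 2)%:E)%E.
have ipE u : square_integrable mu u -> (\int[mu]_y (u y ^+ 2)%:E = 1)%E -> inner mu u u = 1.
  by move=> su /(congr1 fine); rewrite -EFin_inner.
have QI x y z : (\int[mu]_u ((x * v u + y * v0 u + z * w u) ^+ 2)%:E)%E = (Q x y z)%:E.
  by rewrite /Q inner_lin3.
have QE x y z : Q x y z = x ^+ 2 + y ^+ 2 + z ^+ 2 * inner mu w w +
     2 * (x * y * inner mu v v0 + x * z * inner mu v w + y * z * (a0 * S)).
  by rewrite /Q inner_lin3//= (ipE v)// (ipE v0)// !mulr1 Se.
have Q0 x y z : 0 <= Q x y z.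
  by apply: fine_ge0; apply: integral_ge0 => u _; rewrite lee_fin sqr_ge0.
have b0 : 0 <= inner mu v v0 by apply: Rintegral_ge0 => y _; rewrite mulr_ge0.
have [b1 H1 H2 H3] := unit_vectors_inequalities a a0 t QE Q0 b0.
have E (f : T -> R) x y z : (forall u, f u = x * v u + y * v0 u + z * w u) ->
    (\int[mu]_u ((f u) ^+ 2)%:E)%E = (Q x y z)%:E.
  by move=> fE; rewrite -QI; apply: eq_integral => u _; rewrite fE.
(* The witness is half the squared distance of [v] and [v0], hence one minus the [b] of
   [unit_vectors_inequalities]. *)
exists (1 - inner mu v v0); first by rewrite subr_ge0 b1/= lerBlDr lerDl.
rewrite (E (fun y => v y - v0 y) 1 (-1) 0); last by move=> u; ring.
rewrite (E (fun y => a * v y - a0 * v0 y) a (- a0) 0); last by move=> u; ring.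
rewrite (E (fun y => a * v y - (1 + t * s y) * (a0 * v0 y)) a (- a0) (- t));
  last by move=> u; rewrite /w; ring.
rewrite (E (fun y => a * v0 y - (1 + t * S) * (a0 * v0 y)) 0 (a - a0 - t * (a0 * S)) 0);
  last by move=> u; ring.
rewrite (E (fun y => a0 * v y - (1 + t * (s y - S)) * (a0 * v0 y)) a0 (- a0 + t * (a0 * S)) (- t));
  last by move=> u; rewrite /w; ring.
rewrite -(EFin_inner sw) -!EFinM -!EFinD !lee_fin; split => //.
by congr EFin; rewrite QE; ring.
Qed.

(** * Disintegrations and densities along the fibres *)

(** The fibres are a bare family of measures, and measurability of fibre integrals is part of the
    property; pointwise sums of kernels then qualify without being given a kernel structure. *)
Definition disintegration (dX dY : measure_display) (X : measurableType dX)
    (Y : measurableType dY) (R : realType)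
    (lam : {measure set (X * Y)%type -> \bar R}) (m : {measure set X -> \bar R})
    (kap : X -> {measure set Y -> \bar R}) :=
  forall f : X * Y -> \bar R, measurable_fun setT f -> (forall z, 0 <= f z)%E ->
    measurable_fun setT (fun x => \int[kap x]_y f (x, y))%E /\
    (\int[lam]_z f z = \int[m]_x \int[kap x]_y f (x, y))%E.

Section disintegration.
Context (dX dY : measure_display) (X : measurableType dX) (Y : measurableType dY)
  (R : realType).
Local Open Scope ereal_scope.
Implicit Types (lam J : {measure set (X * Y)%type -> \bar R}).
Implicit Types (m Q : {measure set X -> \bar R}).
Implicit Types (kap K : X -> {measure set Y -> \bar R}).

Lemma disintegration_joint (Q : probability X R) (K : R.-pker X ~> Y) :
  disintegration (joint Q K) Q K.
Proof.
move=> f mf f0; split; last exact: ge0_integral_joint.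
exact: measurable_fun_integral_finite_kernel.
Qed.

Lemma disintegration_add_base J J' m m' K :
  disintegration J m K -> disintegration J' m' K ->
  disintegration (measure_add J J') (measure_add m m') K.
Proof.
move=> H H' f mf f0; have [mK JE] := H f mf f0; have [_ J'E] := H' f mf f0.
split => //; rewrite !ge0_integral_measure_add// ?JE ?J'E// => x _.
by apply: integral_ge0.
Qed.

Lemma measurable_fun_pairl d (Z : measurableType d) (f : X * Y -> Z) x :
  measurable_fun setT f -> measurable_fun setT (fun y => f (x, y)).
Proof. by move=> mf; exact: measurableT_comp. Qed.

Lemma measurable_fun_fst d (Z : measurableType d) (f : X -> Z) :
  measurable_fun setT f -> measurable_fun setT (fun z : X * Y => f z.1).
Proof. by move=> mf; exact: measurableT_comp. Qed.

Lemma disintegration_add_fiber J J' m K K' :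
  disintegration J m K -> disintegration J' m K' ->
  disintegration (measure_add J J') m (fun x => measure_add (K x) (K' x)).
Proof.
move=> H H' f mf f0; have [mK JE] := H f mf f0; have [mK' J'E] := H' f mf f0.
have E : (fun x => \int[measure_add (K x) (K' x)]_y f (x, y)) =
    (fun x => \int[K x]_y f (x, y) + \int[K' x]_y f (x, y)).
  apply/funext => x; rewrite ge0_integral_measure_add//.
  exact: measurable_fun_pairl.
rewrite E ge0_integral_measure_add// JE J'E; split.
  exact: emeasurable_funD.
by apply/esym; apply: (@ge0_integralD _ _ _ m _ measurableT
  (fun x => \int[K x]_y f (x, y)) (fun x => \int[K' x]_y f (x, y))) => // x _;
  exact: integral_ge0.
Qed.

(** [q] carries the base from [m] to [Q], while [k] carries [lam] to the law [J] with fibres [K].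
    The marginal enters through [q] alone and the kernel through [k] alone, so two of each serve for
    all four laws. *)
Lemma density_joint lam J m (Q : probability X R) (K : R.-pker X ~> Y) q k :
  disintegration J m K -> density m Q q -> density lam J k ->
  density lam (joint Q K) (fun z => q z.1 * k z)%R.
Proof.
move=> HJ [mq q0 qE] [mk k0 kE]; split.
- by apply: measurable_funM => //; exact: measurable_fun_fst.
- by move=> z; rewrite mulr_ge0.
move=> g mg g0.
have mgq : measurable_fun setT (fun z : X * Y => g z * (q z.1)%:E).
  apply: emeasurable_funM => //; apply/measurable_EFinP.
  exact: measurable_fun_fst.
have gq0 z : 0 <= g z * (q z.1)%:E by rewrite mule_ge0// lee_fin.
have [mK ->] := disintegration_joint Q K mg g0.
rewrite qE//; last by move=> x; exact: integral_ge0.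
transitivity (\int[J]_z (g z * (q z.1)%:E)).
  have [_ ->] := HJ _ mgq gq0; apply: eq_integral => x _.
  by rewrite /= ge0_integralZr// ?lee_fin//; exact: measurable_fun_pairl.
by rewrite kE//; apply: eq_integral => z _; rewrite EFinM muleA.
Qed.

(** Both sides have the same integral over every measurable set of base points. The exceptional null
    set depends on [g]: for [k (x, .)] to be a density of [K x] at almost every x, one would in
    general want a countably generated sigma-algebra on [Y]. The identity is therefore invoked one
    function at a time. *)
Lemma density_fiber lam J m K kap k (g : X * Y -> \bar R) :
  disintegration J m K -> disintegration lam m kap -> density lam J k ->
  measurable_fun setT g -> (forall z, 0 <= g z) -> \int[J]_z g z < +oo ->
  ae_eq m setT (fun x => \int[K x]_y g (x, y))
               (fun x => \int[kap x]_y (g (x, y) * (k (x, y))%:E)).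
Proof.
move=> HJ Hlam [mk k0 kE] mg g0 glt.
have mgk : measurable_fun setT (fun z => g z * (k z)%:E).
  by apply: emeasurable_funM => //; exact/measurable_EFinP.
have gk0 z : 0 <= g z * (k z)%:E by rewrite mule_ge0// lee_fin.
have [mKg JgE] := HJ _ mg g0; have [mkg lgE] := Hlam _ mgk gk0.
have Kg0 x : 0 <= \int[K x]_y g (x, y) by exact: integral_ge0.
apply: integral_ae_eq => //.
  apply/integrableP; split => //.
  by under eq_integral do rewrite gee0_abs//; rewrite -JgE.
move=> E _ mE.
have mI : measurable_fun setT (fun z : X * Y => (\1_E z.1 : R)%:E).
  by apply/measurable_EFinP; apply: measurable_fun_fst.
have mgI : measurable_fun setT (fun z : X * Y => g z * (\1_E z.1 : R)%:E).
  exact: emeasurable_funM.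
have gI0 z : 0 <= g z * (\1_E z.1 : R)%:E by rewrite mule_ge0// lee_fin.
have restrictE (h : X -> \bar R) : \int[m]_(x in E) h x =
    \int[m]_x (h x * (\1_E x : R)%:E).
  rewrite integral_mkcond; apply: eq_integral => x _.
  by rewrite patchE indicE; case: ifPn => _; rewrite ?mule1 ?mule0.
rewrite !restrictE; transitivity (\int[J]_z (g z * (\1_E z.1 : R)%:E)).
  have [_ ->] := HJ _ mgI gI0; apply: eq_integral => x _.
  by rewrite /= ge0_integralZr// ?lee_fin//; exact: measurable_fun_pairl.
rewrite kE//.
have mgIk : measurable_fun setT
    (fun z : X * Y => g z * (k z)%:E * (\1_E z.1 : R)%:E).
  exact: emeasurable_funM.
have gIk0 z : 0 <= g z * (k z)%:E * (\1_E z.1 : R)%:E by rewrite mule_ge0// lee_fin.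
transitivity (\int[lam]_z (g z * (k z)%:E * (\1_E z.1 : R)%:E)).
  by apply: eq_integral => z _; rewrite -!muleA; congr (_ * _); rewrite muleC.
have [_ ->] := Hlam _ mgIk gIk0; apply: eq_integral => x _.
by rewrite /= ge0_integralZr// ?lee_fin//; exact: (measurable_fun_pairl _ mgk).
Qed.

End disintegration.

(* Junk value [0] where [s (x, .)] is not [K x]-integrable. *)
Definition cond_mean (dX dY : measure_display) (X : measurableType dX)
    (Y : measurableType dY) (R : realType) (K : X -> {measure set Y -> \bar R})
    (s : X * Y -> R) (x : X) : R := (\int[K x]_y s (x, y))%R.

Lemma ae_le_integral_affine d (T : measurableType d) (R : realType)
    (m : {measure set T -> \bar R}) (G F H : T -> \bar R) (c e : R) :
  measurable_fun setT G -> measurable_fun setT F -> measurable_fun setT H ->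
  (forall x, 0 <= G x)%E -> (forall x, 0 <= F x)%E -> (forall x, 0 <= H x)%E ->
  0 <= c -> 0 <= e -> {ae m, forall x, (G x <= c%:E * F x + e%:E * H x)%E} ->
  (\int[m]_x G x <= c%:E * \int[m]_x F x + e%:E * \int[m]_x H x)%E.
Proof.
move=> mG mF mH G0 F0 H0 c0 e0 le.
have cF0 x : (0 <= c%:E * F x)%E by rewrite mule_ge0.
have eH0 x : (0 <= e%:E * H x)%E by rewrite mule_ge0.
have mcF : measurable_fun setT (fun x => c%:E * F x)%E by exact: measurable_funeM.
have meH : measurable_fun setT (fun x => e%:E * H x)%E by exact: measurable_funeM.
rewrite -!ge0_integralZl_EFin// -ge0_integralD//.
apply: ae_ge0_le_integral => //.
- by move=> x _; rewrite adde_ge0.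
- exact: emeasurable_funD.
- by apply: filterS le => x.
Qed.

(** * From the fibres back to the product space *)

Section hellinger_factors.
Context (dX dY : measure_display) (X : measurableType dX) (Y : measurableType dY)
  (R : realType).

Lemma integral_fiber_funeposneg (k : {measure set Y -> \bar R}) (g : X * Y -> R) x :
  (\int[k]_y (g (x, y))%:E =
   \int[k]_y (EFin \o g)^\+ (x, y) - \int[k]_y (EFin \o g)^\- (x, y))%E.
Proof.
rewrite [LHS]integralE; congr (_ - _)%E;
  by apply: eq_integral => y _; rewrite ?funeposE ?funenegE.
Qed.

Lemma cond_mean_funeposneg (K : X -> {measure set Y -> \bar R}) (s : X * Y -> R) x :
  cond_mean K s x = fine (\int[K x]_y (EFin \o s)^\+ (x, y) -
                          \int[K x]_y (EFin \o s)^\- (x, y))%E.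
Proof. by rewrite -integral_fiber_funeposneg. Qed.

Lemma measurable_integral_fiber (K : R.-pker X ~> Y) (g : X * Y -> R) :
  measurable_fun setT g ->
  measurable_fun setT (fun x => \int[K x]_y (g (x, y))%:E)%E.
Proof.
move=> mg; have mg' : measurable_fun setT (EFin \o g) by exact/measurable_EFinP.
under eq_fun do rewrite integral_fiber_funeposneg.
apply: emeasurable_funB.
- apply: (measurable_fun_integral_finite_kernel ((EFin \o g)^\+)%E) => //.
  exact: measurable_funepos.
- apply: (measurable_fun_integral_finite_kernel ((EFin \o g)^\-)%E) => //.
  exact: measurable_funeneg.
Qed.

Lemma measurable_cond_mean (K : R.-pker X ~> Y) (s : X * Y -> R) :
  measurable_fun setT s -> measurable_fun setT (cond_mean K s).
Proof.
move=> ms; apply: measurableT_comp; first exact: fine_measurable.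
exact: (measurable_integral_fiber K ms).
Qed.

Lemma hellinger_disintegration (lam : {measure set (X * Y)%type -> \bar R}) m kap
    (q q0 : X -> R) (k k0 c : X * Y -> R) :
  disintegration lam m kap ->
  measurable_fun setT q -> measurable_fun setT q0 ->
  measurable_fun setT k -> measurable_fun setT k0 -> measurable_fun setT c ->
  (forall x, 0 <= q x) -> (forall x, 0 <= q0 x) ->
  let F x := (\int[kap x]_y ((Num.sqrt (q x) * Num.sqrt (k (x, y)) -
      c (x, y) * (Num.sqrt (q0 x) * Num.sqrt (k0 (x, y)))) ^+ 2)%:E)%E in
  measurable_fun setT F /\
  hellinger lam (fun z => q z.1 * k z) (fun z => q0 z.1 * k0 z) c = (\int[m]_x F x)%E.
Proof.
move=> dlam mq mq0 mk mk0 mc q_ge0 q0_ge0 F.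
have mh := @measurable_hellinger _ _ _ (fun z : X * Y => q z.1 * k z)
  (fun z => q0 z.1 * k0 z) c
  (measurable_funM (measurable_fun_fst mq) mk)
  (measurable_funM (measurable_fun_fst mq0) mk0) mc.
have [|mF HE] := dlam _ mh; first by move=> z; rewrite lee_fin sqr_ge0.
have FE : F = (fun x => \int[kap x]_y ((Num.sqrt (q x * k (x, y)) -
      c (x, y) * (Num.sqrt (q0 x * k0 (x, y)))) ^+ 2)%:E)%E.
  by apply/funext => x; apply: eq_integral => y _; rewrite !sqrtrM.
by rewrite FE.
Qed.

(** Integrated form of [fiber_inequality], where [t] stands for half of a parameter increment. The
    weight [b] varies with the pair [Q], [K], and the first bound is what makes it small on
    average. *)
Lemma hellinger_factors (Q Q0 : probability X R) (K K0 : R.-pker X ~> Y)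
    (nu : {measure set (X * Y)%type -> \bar R}) (f f0 f1 f2 s : X * Y -> R) (t : R) :
  density nu (joint Q K) f -> density nu (joint Q0 K0) f0 ->
  density nu (joint Q K0) f1 -> density nu (joint Q0 K) f2 ->
  square_integrable (joint Q0 K0) s ->
  exists2 b : X -> R, measurable_fun setT b /\ (forall x, 0 <= b x <= 1) &
  [/\ \int[Q0]_x (b x)%:E <= hellinger nu f f0 (fun=> 1%R),
      hellinger nu f1 f0 (fun z => 1 + t * cond_mean K0 s z.1)%R <=
        30%:E * hellinger nu f f0 (fun z => 1 + t * s z)%R +
        (42 * t ^+ 2)%:E * \int[joint Q0 K0]_z (b z.1 * s z ^+ 2)%:E
    & hellinger nu f2 f0 (fun z => 1 + t * (s z - cond_mean K0 s z.1))%R <=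
        30%:E * hellinger nu f f0 (fun z => 1 + t * s z)%R +
        (42 * t ^+ 2)%:E * \int[joint Q0 K0]_z (b z.1 * s z ^+ 2)%:E]%E.
Proof.
move=> fP f0P f1P f2P [ms s2].
pose m : {measure set X -> \bar R} := measure_add Q Q0.
have qP := density_Radon_Nikodym (@dominates_measure_addl _ _ _ Q Q0).
have q0P := density_Radon_Nikodym (@dominates_measure_addr _ _ _ Q Q0).
set q := (fun x => Num.max 0 _) in qP; set q0 := (fun x => Num.max 0 _) in q0P.
pose J1 := measure_add (joint Q K) (joint Q0 K).
pose J2 := measure_add (joint Q K0) (joint Q0 K0).
pose lam := measure_add J1 J2.
have kP := density_Radon_Nikodym (@dominates_measure_addl _ _ _ J1 J2).
have k0P := density_Radon_Nikodym (@dominates_measure_addr _ _ _ J1 J2).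
set k := (fun x => Num.max 0 _) in kP; set k0 := (fun x => Num.max 0 _) in k0P.
have dJ1 : disintegration J1 m K.
  by apply: disintegration_add_base; exact: disintegration_joint.
have dJ2 : disintegration J2 m K0.
  by apply: disintegration_add_base; exact: disintegration_joint.
have dlam := disintegration_add_fiber dJ1 dJ2.
rewrite -/lam in dlam; set kap := (fun x => measure_add (K x) (K0 x)) in dlam.
have gP := density_joint dJ1 qP kP.
have g0P := density_joint dJ2 q0P k0P.
have g1P := density_joint dJ2 qP k0P.
have g2P := density_joint dJ1 q0P kP.
have [mq q_ge0 _] := qP; have [mq0 q0_ge0 q0E] := q0P.
have [mk k_ge0 _] := kP; have [mk0 k0_ge0 k0E] := k0P.
pose S := cond_mean K0 s.
have mS : measurable_fun setT (fun z : X * Y => S z.1).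
  by apply: measurable_fun_fst; exact: measurable_cond_mean.
have m1ts : measurable_fun setT (fun z : X * Y => 1 + t * s z).
  by apply: measurable_funD => //; exact: measurable_funM.
have m1tS : measurable_fun setT (fun z : X * Y => 1 + t * S z.1).
  by apply: measurable_funD => //; exact: measurable_funM.
have m1tsS : measurable_fun setT (fun z : X * Y => 1 + t * (s z - S z.1)).
  apply: measurable_funD => //; apply: measurable_funM => //.
  exact: measurable_funB.
have m11 : measurable_fun setT (fun z : X * Y => 1 : R) by [].
rewrite (hellinger_indep m11 fP f0P gP g0P).
rewrite (hellinger_indep m1ts fP f0P gP g0P).
rewrite (hellinger_indep m1tS f1P f0P g1P g0P).
rewrite (hellinger_indep m1tsS f2P f0P g2P g0P).
have [mF11 ->] := hellinger_disintegration dlam mq mq0 mk mk0 m11 q_ge0 q0_ge0.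
have [mFs ->] := hellinger_disintegration dlam mq mq0 mk mk0 m1ts q_ge0 q0_ge0.
have [mFS ->] := hellinger_disintegration dlam mq mq0 mk0 mk0 m1tS q_ge0 q0_ge0.
have [mFsS ->] := hellinger_disintegration dlam mq0 mq0 mk mk0 m1tsS q0_ge0 q0_ge0.
(* The root of [q0] makes [u] square-integrable under the whole of [J2], whose marginal is [m] and
   not just [Q0]; its fibre norms are then finite at [m]-almost every point. *)
pose u (z : X * Y) := Num.sqrt (q0 z.1) * s z.
have mu : measurable_fun setT u.
  by apply: measurable_funM => //; apply: measurable_sqrt_fun; exact: measurable_fun_fst.
have msq (h : X * Y -> R) : measurable_fun setT h ->
    measurable_fun setT (fun z => ((h z) ^+ 2)%:E).
  by move=> mh; apply/measurable_EFinP; exact: measurable_funX.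
have sq0 (h : X * Y -> R) z : (0 <= ((h z) ^+ 2)%:E)%E by rewrite lee_fin sqr_ge0.
have uE : (\int[J2]_z ((u z) ^+ 2)%:E = \int[joint Q0 K0]_z ((s z) ^+ 2)%:E)%E.
  have one : density J2 J2 (fun=> 1).
    by split => // g mg g0; apply: eq_integral => z _; rewrite mule1.
  have [_ _ ->] := density_joint dJ2 q0P one; [|exact: msq|exact: sq0].
  apply: eq_integral => z _; rewrite /u exprMn sqr_sqrtr// -EFinM mulr1.
  by rewrite mulrC.
have u2 : (\int[J2]_z ((u z) ^+ 2)%:E < +oo)%E by rewrite uE.
have cst1 (J : {finite_measure set (X * Y)%type -> \bar R}) :
    (\int[J]_z (cst 1%E z) < +oo)%E.
  by rewrite integral_cst// mul1e ltey_eq fin_num_measure.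
have iu : J2.-integrable setT (EFin \o u).
  have s1 : square_integrable J2 (fun=> 1).
    by split => //; under eq_integral do rewrite expr1n; exact: cst1.
  have := square_integrableM (conj mu u2) s1.
  by congr (_.-integrable _ _); apply/funext => z /=; rewrite mulr1.
have mu' : measurable_fun setT (EFin \o u) by exact/measurable_EFinP.
have lt_pos : (\int[J2]_z (EFin \o u)^\+ z < +oo)%E.
  have /integrableP[_] := integrable_funepos measurableT iu.
  by under eq_integral do rewrite gee0_abs ?funepos_ge0//.
have lt_neg : (\int[J2]_z (EFin \o u)^\- z < +oo)%E.
  have /integrableP[_] := integrable_funeneg measurableT iu.
  by under eq_integral do rewrite gee0_abs ?funeneg_ge0//.
(* The functions for which the fibre identity is invoked: the constant 1 for both kernels gives the
   unit lengths, the square of [u] gives |w|^2, and its positive and negative parts give <v0, w>. *)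
have A1 := density_fiber dJ1 dlam kP (measurable_cst 1%E) (fun=> lee01) (cst1 J1).
have A2 := density_fiber dJ2 dlam k0P (measurable_cst 1%E) (fun=> lee01) (cst1 J2).
have A3 := density_fiber dJ2 dlam k0P (msq _ mu) (sq0 u) u2.
have A4 := density_fiber dJ2 dlam k0P (measurable_funepos mu')
  (funepos_ge0 (EFin \o u)) lt_pos.
have A5 := density_fiber dJ2 dlam k0P (measurable_funeneg mu')
  (funeneg_ge0 (EFin \o u)) lt_neg.
have A6 : {ae m, forall x, setT x -> (\int[K0 x]_y ((u (x, y)) ^+ 2)%:E)%E \is a fin_num}.
  have [mKu JE] := dJ2 _ (msq _ mu) (sq0 u).
  apply: integrable_ae => //; apply/integrableP; split => //.
  under eq_integral do rewrite gee0_abs ?integral_ge0//.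
  by rewrite -JE.
have mkk0 : measurable_fun setT (fun z => Num.sqrt (k z) - Num.sqrt (k0 z)).
  by apply: measurable_funB; exact: measurable_sqrt_fun.
pose dv x := (\int[kap x]_y ((Num.sqrt (k (x, y)) - Num.sqrt (k0 (x, y))) ^+ 2)%:E)%E.
have [mdv _] := dlam _ (msq _ mkk0) (sq0 _).
(* The cap at 1 and [fine] make the weight real and bounded at every x; at almost every x it is the
   one provided by [fiber_inequality]. *)
pose b x := Num.min 1 (fine (dv x) / 2).
have mb : measurable_fun setT b.
  apply: measurable_minr => //; apply: measurable_funM => //.
  by apply: measurableT_comp; [exact: fine_measurable|exact: mdv].
have b01 x : 0 <= b x <= 1.
  rewrite le_min ler01/= ge_min lexx divr_ge0// fine_ge0//.
  by apply: integral_ge0 => y _; exact: (sq0 (fun=> _) (x, y)).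
pose n x := (\int[kap x]_y ((Num.sqrt (q0 x) * s (x, y) * Num.sqrt (k0 (x, y))) ^+ 2)%:E)%E.
have core : {ae m, forall x,
  [/\ ((b x)%:E * (q0 x)%:E <= \int[kap x]_y ((Num.sqrt (q x) * Num.sqrt (k (x, y)) -
          1 * (Num.sqrt (q0 x) * Num.sqrt (k0 (x, y)))) ^+ 2)%:E)%E,
      (\int[kap x]_y ((Num.sqrt (q x) * Num.sqrt (k0 (x, y)) -
          (1 + t * S x) * (Num.sqrt (q0 x) * Num.sqrt (k0 (x, y)))) ^+ 2)%:E <=
       30%:E * \int[kap x]_y ((Num.sqrt (q x) * Num.sqrt (k (x, y)) -
          (1 + t * s (x, y)) * (Num.sqrt (q0 x) * Num.sqrt (k0 (x, y)))) ^+ 2)%:E +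
       (42 * t ^+ 2)%:E * ((b x)%:E * n x))%E &
      (\int[kap x]_y ((Num.sqrt (q0 x) * Num.sqrt (k (x, y)) -
          (1 + t * (s (x, y) - S x)) * (Num.sqrt (q0 x) * Num.sqrt (k0 (x, y)))) ^+ 2)%:E <=
       30%:E * \int[kap x]_y ((Num.sqrt (q x) * Num.sqrt (k (x, y)) -
          (1 + t * s (x, y)) * (Num.sqrt (q0 x) * Num.sqrt (k0 (x, y)))) ^+ 2)%:E +
       (42 * t ^+ 2)%:E * ((b x)%:E * n x))%E]}.
  have fI U V := @filterI _ _ (ae_filter_ringOfSetsType m) U V.
  have A := fI _ _ A1 (fI _ _ A2 (fI _ _ A3 (fI _ _ A4 (fI _ _ A5 A6)))).
  apply: filterS A => x [/(_ I) h1 [/(_ I) h2 [/(_ I) h3 [/(_ I) h4 [/(_ I) h5 /(_ I) h6]]]]].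
  have K1 (H : R.-pker X ~> Y) : (\int[H x]_y (cst 1%E (x, y)) = 1)%E.
    by rewrite integral_cst// mul1e prob_kernel.
  have mkx : measurable_fun setT (fun y => Num.sqrt (k (x, y))).
    by apply: measurable_sqrt_fun; exact: measurable_fun_pairl.
  have mk0x : measurable_fun setT (fun y => Num.sqrt (k0 (x, y))).
    by apply: measurable_sqrt_fun; exact: measurable_fun_pairl.
  have v1 : (\int[kap x]_y ((Num.sqrt (k (x, y))) ^+ 2)%:E = 1)%E.
    rewrite -(K1 K) h1; apply: eq_integral => y _.
    by rewrite sqr_sqrtr// mul1e.
  have v01 : (\int[kap x]_y ((Num.sqrt (k0 (x, y))) ^+ 2)%:E = 1)%E.
    rewrite -(K1 K0) h2; apply: eq_integral => y _.
    by rewrite sqr_sqrtr// mul1e.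
  have sw : square_integrable (kap x)
      (fun y => Num.sqrt (q0 x) * s (x, y) * Num.sqrt (k0 (x, y))).
    split.
      by apply: measurable_funM => //; exact: (measurable_fun_pairl _ mu).
    rewrite (_ : (\int[_]_y _)%E = (\int[K0 x]_y ((u (x, y)) ^+ 2)%:E)%E).
      by rewrite ltey_eq h6.
    rewrite h3; apply: eq_integral => y _.
    by rewrite exprMn sqr_sqrtr// EFinM.
  have Se : Num.sqrt (q0 x) * S x = inner (kap x) (fun y => Num.sqrt (k0 (x, y)))
      (fun y => Num.sqrt (q0 x) * s (x, y) * Num.sqrt (k0 (x, y))).
    have -> : Num.sqrt (q0 x) * S x = cond_mean K0 u x.
      (* Where [q0] vanishes, [S x] may be a default value, but both sides are 0. Elsewhere
         [u (x, .)] is integrable and the root of [q0 x] can be divided out. *)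
      have [c0|c0] := eqVneq (Num.sqrt (q0 x)) 0.
        rewrite c0 mul0r /cond_mean /u; under eq_Rintegral do rewrite c0 mul0r.
        by rewrite Rintegral_cst// mul0r.
      have iux : (K0 x).-integrable setT (EFin \o (fun y => u (x, y))).
        have sux : square_integrable (K0 x) (fun y => u (x, y)).
          by split; [exact: measurable_fun_pairl|rewrite ltey_eq h6].
        have s1 : square_integrable (K0 x) (fun=> 1).
          split => //; under eq_integral do rewrite expr1n.
          by rewrite (K1 K0) ltry.
        have := square_integrableM sux s1.
        by congr (_.-integrable _ _); apply/funext => y /=; rewrite mulr1.
      have -> : S x = (\int[K0 x]_y ((Num.sqrt (q0 x))^-1 * u (x, y)))%R.
        by apply: eq_Rintegral => y _; rewrite /u mulrA mulVf// mul1r.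
      by rewrite RintegralZl// mulrA mulfV// mul1r.
    rewrite cond_mean_funeposneg h4 h5 /inner /Rintegral [in RHS]integralE.
    have wE y : Num.sqrt (k0 (x, y)) * (Num.sqrt (q0 x) * s (x, y) *
        Num.sqrt (k0 (x, y))) = u (x, y) * k0 (x, y).
      by rewrite mulrCA -expr2 sqr_sqrtr.
    congr (fine (_ - _)%E); apply: eq_integral => y _.
      rewrite !funeposE /= wE -!EFin_max -EFinM; congr EFin.
      by rewrite maxr_pMl// mul0r.
    rewrite !funenegE /= wE -!EFin_max -EFinM; congr EFin.
    by rewrite maxr_pMl// mul0r mulNr.
  have [b' b'01 [H0 H1 H2 H3]] := fiber_inequality (Num.sqrt (q x)) t mkx mk0x
    (fun y => sqrtr_ge0 _) (fun y => sqrtr_ge0 _) v1 v01 sw Se.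
  have bE : b x = b'.
    rewrite /b /dv H0 /= mulrC mulKf ?pnatr_eq0// min_r//.
    by case/andP: b'01.
  rewrite bE; split => //.
  rewrite -EFinM -[X in b' * X]sqr_sqrtr// [b' * _]mulrC; apply: (le_trans H1).
  by under [leRHS]eq_integral do rewrite mul1r.
have core' (A B C : X -> Prop) : {ae m, forall x, [/\ A x, B x & C x]} ->
    [/\ {ae m, forall x, A x}, {ae m, forall x, B x} & {ae m, forall x, C x}].
  by move=> ABC; split; apply: filterS ABC => x [].
have [c1 c2 c3] := core' _ _ _ core.
have C0 : 0 <= 42 * t ^+ 2 by rewrite mulr_ge0// sqr_ge0.
have mw : measurable_fun setT (fun z : X * Y =>
    Num.sqrt (q0 z.1) * s z * Num.sqrt (k0 z)).
  by apply: measurable_funM => //; exact: measurable_sqrt_fun.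
have [mn _] := dlam _ (msq _ mw) (sq0 _).
have n0 x : (0 <= n x)%E by apply: integral_ge0 => y _; rewrite lee_fin sqr_ge0.
have bn0 x : (0 <= (b x)%:E * n x)%E.
  by rewrite mule_ge0// lee_fin; case/andP: (b01 x).
have mbn : measurable_fun setT (fun x => (b x)%:E * n x)%E.
  by apply: emeasurable_funM => //; exact/measurable_EFinP.
(* The integrand of [n] contains q0 k0, the density of [joint Q0 K0] in [lam]. *)
have bnE : (\int[m]_x ((b x)%:E * n x) =
    \int[joint Q0 K0]_z (b z.1 * s z ^+ 2)%:E)%E.
  have [_ _ g0E] := g0P.
  have mbs : measurable_fun setT (fun z : X * Y => (b z.1 * s z ^+ 2)%:E).
    apply/measurable_EFinP; apply: measurable_funM; last exact: measurable_funX.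
    exact: measurable_fun_fst.
  have bs0 z : (0 <= (b z.1 * s z ^+ 2)%:E)%E.
    by rewrite lee_fin mulr_ge0 ?sqr_ge0//; case/andP: (b01 z.1).
  rewrite g0E//.
  have mI : measurable_fun setT (fun z : X * Y =>
      ((b z.1)%:E * ((Num.sqrt (q0 z.1) * s z * Num.sqrt (k0 z)) ^+ 2)%:E)%E).
    apply: emeasurable_funM; last exact: msq.
    by apply/measurable_EFinP; exact: measurable_fun_fst.
  have I1 z : (0 <= (b z.1)%:E * ((Num.sqrt (q0 z.1) * s z * Num.sqrt (k0 z)) ^+ 2)%:E)%E.
    by rewrite mule_ge0 ?lee_fin ?sqr_ge0//; case/andP: (b01 z.1).
  transitivity (\int[lam]_z ((b z.1)%:E *
      ((Num.sqrt (q0 z.1) * s z * Num.sqrt (k0 z)) ^+ 2)%:E))%E.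
    have [_ ->] := dlam _ mI I1; apply: eq_integral => x _ /=.
    have mwx := measurable_fun_pairl x (msq _ mw).
    by have /andP[bx0 _] := b01 x; rewrite ge0_integralZl_EFin// => y _;
      rewrite lee_fin sqr_ge0.
  apply: eq_integral => z _; rewrite -!EFinM; congr EFin.
  by rewrite !exprMn !sqr_sqrtr//; ring.
exists b => //; split.
- rewrite q0E//; last 2 first.
  - exact/measurable_EFinP.
  - by move=> x; rewrite lee_fin; case/andP: (b01 x).
  apply: ae_ge0_le_integral => //.
  - by move=> x _; rewrite mule_ge0 ?lee_fin//; case/andP: (b01 x).
  - by apply: emeasurable_funM; exact/measurable_EFinP.
  - by move=> x _; apply: integral_ge0 => y _; rewrite lee_fin sqr_ge0.
  - by apply: filterS c1 => x.
- rewrite -bnE; apply: ae_le_integral_affine c2 => // x;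
    by apply: integral_ge0 => y _; rewrite lee_fin sqr_ge0.
- rewrite -bnE; apply: ae_le_integral_affine c3 => // x;
    by apply: integral_ge0 => y _; rewrite lee_fin sqr_ge0.
Qed.

End hellinger_factors.

(** * Differentiability in quadratic mean of the factors *)

Section truncation.
Context d (T : measurableType d) (R : realType).

Lemma ereal_cvg0P (I : Type) (F : set_system I) (FF : Filter F) (f : I -> \bar R) :
  (forall i, 0 <= f i)%E ->
  (f i @[i --> F] --> 0%E) <-> (forall e, 0 < e -> \forall i \near F, (f i <= e%:E)%E).
Proof.
move=> f0; have fabs i : f i \is a fin_num -> `|fine (f i)| = fine (f i).
  by move=> fi; rewrite ger0_norm// fine_ge0.
split.
- move=> /fine_cvgP[ffin /cvgr0Pnorm_le fe] e e0.
  have fle := fe e e0.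
  apply: filterS2 ffin fle => i fi /=.
  by rewrite fabs// -lee_fin fineK.
- move=> H.
  have ffin : \forall i \near F, f i \is a fin_num.
    apply: filterS (H 1 ltr01) => i fi; rewrite ge0_fin_numE//.
    exact: le_lt_trans fi (ltry _).
  apply/fine_cvgP; split => //; apply/cvgr0Pnorm_le => e e0.
  apply: filterS2 ffin (H e e0) => i fi /=.
  by rewrite fabs// -lee_fin fineK.
Qed.

Lemma integral_tail_small (P : {measure set T -> \bar R}) (s : T -> R) :
  square_integrable P s -> forall e, 0 < e -> exists M : nat,
  (\int[P]_z ((s z) ^+ 2 * (M%:R < (s z) ^+ 2)%R%:R)%:E <= e%:E)%E.
Proof.
move=> [ms s2] e e0.
have ms2 : measurable_fun setT (fun z => (s z) ^+ 2) by exact: measurable_funX.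
pose g (n : nat) z := ((s z) ^+ 2 * (n%:R < (s z) ^+ 2)%R%:R)%:E.
have g0 n z : (0 <= g n z)%E by rewrite lee_fin mulr_ge0 ?sqr_ge0.
have mg n : measurable_fun setT (g n).
  apply/measurable_EFinP; apply: measurable_funM => //.
  have mb : measurable_fun setT (fun z => (n%:R < (s z) ^+ 2)%R).
    exact: measurable_fun_ltr.
  rewrite (_ : (fun z => _%:R) = fun z => if (n%:R < (s z) ^+ 2)%R then 1 else 0).
    exact: measurable_fun_ifT.
  by apply/funext => z; case: (_ < _)%R.
have is2 : P.-integrable setT (EFin \o (fun z => (s z) ^+ 2)).
  apply/integrableP; split; first exact/measurable_EFinP.
  by under eq_integral do rewrite gee0_abs ?lee_fin ?sqr_ge0//.
have gcvg : {ae P, forall z, setT z -> g ^~ z @ \oo --> cst 0%E z}.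
  apply: aeW => z _; apply: cvg_near_cst.
  near=> n; rewrite /g (_ : _ < _ = false) ?mulr0//.
  apply/negbTE; rewrite -leNgt.
  near: n; exact: nbhs_infty_ger.
have gle : {ae P, forall z n, setT z -> (`|g n z| <= (EFin \o (fun z => s z ^+ 2)%R) z)%E}.
  apply: aeW => z n _; rewrite gee0_abs// lee_fin.
  by rewrite ler_piMr ?sqr_ge0//; case: (_ < _)%R => //=.
have [_ _ gint] := dominated_convergence measurableT mg (measurable_cst 0%E) gcvg is2 gle.
have G0 n : (0 <= \int[P]_z g n z)%E by apply: integral_ge0 => z _; exact: g0.
move: gint; rewrite integral_cst//= mul0e => gint.
have [M _ HM] := (ereal_cvg0P _ G0).1 gint e e0.
by exists M; exact: (HM M (leqnn M)).
Unshelve. all: by end_near. Qed.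

End truncation.

(** Truncation of s^2 at a level M: b s^2 is at most M b plus the part of s^2 above M, whose
    integral is at most e / 2. [eta] is fixed before [b] because the weights change with the
    parameter; the 1 added to M in it covers M = 0. *)
Lemma small_weight (dX dY : measure_display) (X : measurableType dX)
    (Y : measurableType dY) (R : realType) (Q : probability X R)
    (K : R.-pker X ~> Y) (s : X * Y -> R) :
  square_integrable (joint Q K) s -> forall e, 0 < e -> exists2 eta, 0 < eta &
  forall b : X -> R, measurable_fun setT b -> (forall x, 0 <= b x <= 1) ->
    (\int[Q]_x (b x)%:E <= eta%:E)%E ->
    (\int[joint Q K]_z (b z.1 * s z ^+ 2)%:E <= e%:E)%E.
Proof.
move=> ss e e0; have e20 : 0 < e / 2 by rewrite divr_gt0.
have [M HM] := integral_tail_small ss e20; have [ms _] := ss.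
have M0 : 0 <= M%:R :> R by [].
exists (e / 2 / (M%:R + 1)); first by rewrite divr_gt0// ltr_wpDl.
move=> b mb b01 bQ; have b0 x : 0 <= b x by case/andP: (b01 x).
have mb1 : measurable_fun setT (fun z : X * Y => (b z.1)%:E).
  by apply/measurable_EFinP; exact: measurable_fun_fst.
have bE : (\int[joint Q K]_z (b z.1)%:E = \int[Q]_x (b x)%:E)%E.
  rewrite ge0_integral_joint//; last by move=> z; rewrite lee_fin.
  apply: eq_integral => x _ /=.
  by rewrite integral_cst// prob_kernel mule1.
have ms2 : measurable_fun setT (fun z => (s z) ^+ 2) by exact: measurable_funX.
pose g z := ((s z) ^+ 2 * (M%:R < (s z) ^+ 2)%R%:R)%:E.
have mg : measurable_fun setT g.
  apply/measurable_EFinP; apply: measurable_funM => //.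
  rewrite (_ : (fun z => _%:R) = fun z => if (M%:R < (s z) ^+ 2)%R then 1 else 0).
    by apply: measurable_fun_ifT => //; exact: measurable_fun_ltr.
  by apply/funext => z; case: (_ < _)%R.
apply: (@le_trans _ _ ((M%:R)%:E * \int[joint Q K]_z (b z.1)%:E
                       + 1%:E * \int[joint Q K]_z g z)%E).
  apply: ae_le_integral_affine => //.
  - by apply/measurable_EFinP; apply: measurable_funM => //; exact: measurable_fun_fst.
  - by move=> z; rewrite lee_fin mulr_ge0// sqr_ge0.
  - by move=> z; rewrite lee_fin.
  - by move=> z; rewrite lee_fin mulr_ge0// sqr_ge0.
  apply: aeW => z; rewrite /g -!EFinM -EFinD lee_fin mul1r.
  have /andP[bz0 bz1] := b01 z.1.
  case: ltP => h; rewrite ?mulr1 ?mulr0 ?addr0.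
    by rewrite -[leLHS]add0r lerD// ?mulr_ge0// ler_piMl// sqr_ge0.
  by rewrite mulrC ler_wpM2r.
rewrite mul1e bE.
apply: (@le_trans _ _ ((M%:R)%:E * (e / 2 / (M%:R + 1))%:E + (e / 2)%:E)%E).
  by rewrite leeD// lee_wpmul2l.
rewrite -EFinM -EFinD lee_fin.
rewrite [leRHS](splitr e) lerD2r mulrCA ler_piMr ?(ltW e20)//.
by rewrite ler_pdivrMr ?ltr_wpDl// mul1r lerDl.
Qed.

Section quadratic_mean.
Context d (T : measurableType d) (R : realType).
Variable nu : {sigma_finite_measure set T -> \bar R}.

Definition radon_density (P : probability T R) (z : T) : R :=
  Num.max 0 (fine (Radon_Nikodym (charge_of_finite_measure P) nu z)).

Lemma sqrt_densityE P z : sqrt_density nu P z = Num.sqrt (radon_density P z).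
Proof.
rewrite /sqrt_density /radon_density; set r := fine _.
by case: leP => // r0; rewrite sqrtr0 ler0_sqrtr// ltW.
Qed.

(** The remainder regroups into the root of p_t minus 1 + (t - t0) / 2 s times the root of p_t0.
    Multiplying out (t - t0)^-2 is legitimate because the punctured neighbourhood excludes [t0]. *)
Lemma dqmP (Pt : R -> probability T R) t0 s :
  differentiable_in_quadratic_mean nu Pt t0 s <->
  forall e, 0 < e -> \forall t \near t0^',
    (hellinger nu (radon_density (Pt t)) (radon_density (Pt t0))
       (fun z => 1 + (t - t0) / 2 * s z)%R <= (e * (t - t0) ^+ 2)%:E)%E.
Proof.
rewrite /differentiable_in_quadratic_mean.
rewrite (_ : (fun t => _) = fun t => (((t - t0) ^- 2)%:E *
    hellinger nu (radon_density (Pt t)) (radon_density (Pt t0))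
       (fun z => 1 + (t - t0) / 2 * s z)%R)%E); last first.
  apply/funext => t; congr (_ * _)%E; apply: eq_integral => z _; congr EFin.
  by rewrite !sqrt_densityE; congr (_ ^+ 2); ring.
have F0 t : (0 <= ((t - t0) ^- 2)%:E *
    hellinger nu (radon_density (Pt t)) (radon_density (Pt t0))
       (fun z => 1 + (t - t0) / 2 * s z)%R)%E.
  rewrite mule_ge0 ?lee_fin ?invr_ge0 ?sqr_ge0//.
  by apply: integral_ge0 => z _; rewrite lee_fin sqr_ge0.
have E e t : t != t0 -> (((t - t0) ^- 2)%:E *
    hellinger nu (radon_density (Pt t)) (radon_density (Pt t0))
       (fun z => 1 + (t - t0) / 2 * s z)%R <= e%:E)%E =
    (hellinger nu (radon_density (Pt t)) (radon_density (Pt t0))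
       (fun z => 1 + (t - t0) / 2 * s z)%R <= (e * (t - t0) ^+ 2)%:E)%E.
  move=> tt0; rewrite lee_pdivrMl//; last first.
    by rewrite exprn_even_gt0//= subr_eq0.
  by rewrite -EFinM [(_ ^+ 2 * e)%R]mulrC.
split.
- move=> /(ereal_cvg0P _ F0) H e e0.
  have He := H e e0.
  by apply: filterS2 He (nbhs_dnbhs_neq t0) => t /[swap] tt0; rewrite E.
- move=> H; apply/(ereal_cvg0P _ F0) => e e0.
  have He := H e e0.
  by apply: filterS2 He (nbhs_dnbhs_neq t0) => t /[swap] tt0; rewrite E.
Qed.

(** Removes the score from the remainder: when the remainder is of order t^2, so is the squared
    distance itself, which in turn bounds the mean of the weight [b]. *)
Lemma hellinger_one_le (P P0 : {finite_measure set T -> \bar R}) f f0 (s : T -> R) t :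
  density nu P f -> density nu P0 f0 -> measurable_fun setT s ->
  (hellinger nu f f0 (fun=> 1%R) <=
   2%:E * hellinger nu f f0 (fun z => 1 + t * s z)%R +
   (2 * t ^+ 2)%:E * \int[P0]_z (s z ^+ 2)%:E)%E.
Proof.
move=> [mf f_ge0 _] [mf0 f0_ge0 f0E] ms.
have ms2 : measurable_fun setT (fun z => (s z ^+ 2)%:E).
  by apply/measurable_EFinP; exact: measurable_funX.
rewrite f0E//; last by move=> z; rewrite lee_fin sqr_ge0.
apply: ae_le_integral_affine => //.
- exact: measurable_hellinger.
- apply: measurable_hellinger => //; apply: measurable_funD => //.
  exact: measurable_funM.
- by apply: emeasurable_funM => //; exact/measurable_EFinP.
- by move=> z; rewrite lee_fin sqr_ge0.
- by move=> z; rewrite lee_fin sqr_ge0.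
- by move=> z; rewrite mule_ge0 ?lee_fin ?sqr_ge0.
- by rewrite mulr_ge0// sqr_ge0.
apply: aeW => z; rewrite -!EFinM -EFinD lee_fin -[X in s z ^+ 2 * X]sqr_sqrtr//.
move: (Num.sqrt (f z)) (Num.sqrt (f0 z)) (s z) => x y u.
rewrite -subr_ge0 (_ : _ - _ = (x - y - 2 * t * u * y) ^+ 2); last by ring.
exact: sqr_ge0.
Qed.

End quadratic_mean.

Section quadratic_mean_factors.
Context (dX dY : measure_display) (X : measurableType dX) (Y : measurableType dY)
  (R : realType).
Variable nu : {sigma_finite_measure set (X * Y)%type -> \bar R}.

Lemma dqm_factors (Q : R -> probability X R) (K : R -> R.-pker X ~> Y)
    (Pt : R -> probability (X * Y)%type R) (t0 : R) (T : set R) (s : X * Y -> R) :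
  nbhs t0 T ->
  (forall t, T t -> Pt t = joint (Q t) (K t) :> probability (X * Y)%type R) ->
  (forall t, T t -> [/\ joint (Q t) (K t) `<< nu, joint (Q t) (K t0) `<< nu
                      & joint (Q t0) (K t) `<< nu]) ->
  square_integrable (joint (Q t0) (K t0)) s ->
  differentiable_in_quadratic_mean nu Pt t0 s ->
  differentiable_in_quadratic_mean nu
    (fun t => joint (Q t) (K t0) : probability (X * Y)%type R) t0
    (fun z => cond_mean (K t0) s z.1) /\
  differentiable_in_quadratic_mean nu
    (fun t => joint (Q t0) (K t) : probability (X * Y)%type R) t0
    (fun z => s z - cond_mean (K t0) s z.1).
Proof.
move=> nT PtE dom ss /dqmP dqm.
have T0 : T t0 by exact: nbhs_singleton.
have dT : \forall t \near t0^', T t by apply: nbhs_dnbhs.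
have [ms s2] := ss.
have dens (Q' : probability X R) (K' : R.-pker X ~> Y) : joint Q' K' `<< nu ->
    density nu (joint Q' K') (radon_density nu (joint Q' K')).
  by move=> h; exact: density_Radon_Nikodym.
have [d0 _ _] := dom t0 T0.
pose A := fine (\int[joint (Q t0) (K t0)]_z ((s z) ^+ 2)%:E)%E.
have AE : (\int[joint (Q t0) (K t0)]_z ((s z) ^+ 2)%:E)%E = A%:E.
  rewrite fineK// ge0_fin_numE//; apply: integral_ge0 => z _.
  by rewrite lee_fin sqr_ge0.
have A0 : 0 <= A.
  by apply: fine_ge0; apply: integral_ge0 => z _; rewrite lee_fin sqr_ge0.
have key e : 0 < e -> \forall t \near t0^',
    (hellinger nu (radon_density nu (joint (Q t) (K t0)))
       (radon_density nu (joint (Q t0) (K t0)))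
       (fun z => 1 + (t - t0) / 2 * cond_mean (K t0) s z.1)%R
       <= (e * (t - t0) ^+ 2)%:E)%E /\
    (hellinger nu (radon_density nu (joint (Q t0) (K t)))
       (radon_density nu (joint (Q t0) (K t0)))
       (fun z => 1 + (t - t0) / 2 * (s z - cond_mean (K t0) s z.1))%R
       <= (e * (t - t0) ^+ 2)%:E)%E.
  move=> e0.
  (* The two error terms share [e] equally: 30 times e / 60 is e / 2, and 42 ((t - t0) / 2)^2 times
     e / 21 is e / 2 times (t - t0)^2. *)
  have e21 : 0 < e / 21 by rewrite divr_gt0.
  have e60 : 0 < e / 60 by rewrite divr_gt0.
  have [eta eta0 Heta] := small_weight ss e21.
  have near1 := dqm 1 ltr01; have near2 := dqm _ e60.
  (* This quantity bounds the squared distance of the laws at t and t0, by [hellinger_one_le] for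
     the half increment and a remainder of at most (t - t0)^2 from [near1]. *)
  have near3 : \forall t \near t0^', (2 + A / 2) * (t - t0) ^+ 2 <= eta.
    apply: nbhs_dnbhs.
    have c0 : 0 < 2 + A / 2 by rewrite ltr_wpDr// divr_ge0.
    have : \forall t \near t0, `|t0 - t| <= Num.sqrt (eta / (2 + A / 2)).
      have /cvgrPdist_le : (fun t : R => t) @ t0 --> t0 by exact: cvg_id.
      by apply; rewrite sqrtr_gt0 divr_gt0.
    apply: filterS => t; rewrite distrC => h.
    have : `|t - t0| ^+ 2 <= Num.sqrt (eta / (2 + A / 2)) ^+ 2.
      by rewrite lerXn2r// ?nnegrE ?sqrtr_ge0.
    rewrite sqr_sqrtr; last by rewrite divr_ge0// ltW.
    by rewrite real_normK ?num_real// ler_pdivlMr// mulrC.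
  apply: filterS3 (filterI near1 dT) near2 near3 => t [h1 Tt] h2 h3.
  have [dt dtX dtY] := dom t Tt.
  move: h1 h2; rewrite !PtE// mul1r => h1 h2.
  have [b [mb b01] [B1 B2 B3]] := hellinger_factors ((t - t0) / 2)
    (dens _ _ dt) (dens _ _ d0) (dens _ _ dtX) (dens _ _ dtY) ss.
  have Ib : (\int[joint (Q t0) (K t0)]_z (b z.1 * s z ^+ 2)%:E <= (e / 21)%:E)%E.
    apply: Heta => //; apply: (le_trans B1).
    apply: (le_trans (hellinger_one_le ((t - t0) / 2) (dens _ _ dt) (dens _ _ d0) ms)).
    rewrite AE; apply: (@le_trans _ _ (2%:E * ((t - t0) ^+ 2)%:E +
       (2 * ((t - t0) / 2) ^+ 2)%:E * A%:E)%E).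
      by rewrite leeD2r// lee_wpmul2l.
    rewrite -!EFinM -EFinD lee_fin; apply: le_trans h3.
    by rewrite le_eqVlt; apply/orP; left; apply/eqP; field.
  have fin : (30%:E * hellinger nu (radon_density nu (joint (Q t) (K t)))
       (radon_density nu (joint (Q t0) (K t0)))
       (fun z => 1 + (t - t0) / 2 * s z)%R +
      (42 * ((t - t0) / 2) ^+ 2)%:E *
        \int[joint (Q t0) (K t0)]_z (b z.1 * s z ^+ 2)%:E
      <= (e * (t - t0) ^+ 2)%:E)%E.
    apply: (@le_trans _ _ (30%:E * (e / 60 * (t - t0) ^+ 2)%:E +
       (42 * ((t - t0) / 2) ^+ 2)%:E * (e / 21)%:E)%E).
      by rewrite leeD// lee_wpmul2l// lee_fin mulr_ge0// sqr_ge0.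
    rewrite -!EFinM -EFinD lee_fin.
    by rewrite le_eqVlt; apply/orP; left; apply/eqP; field.
  by split; [exact: le_trans B2 fin|exact: le_trans B3 fin].
by split; apply/dqmP => e e0; apply: filterS (key e e0) => t [].
Qed.

End quadratic_mean_factors.

(** * The conditional mean as an orthogonal projection *)

Section cond_mean_theory.
Context (dX dY : measure_display) (X : measurableType dX) (Y : measurableType dY)
  (R : realType) (Q : probability X R) (K : R.-pker X ~> Y).
Local Notation P := (joint Q K).

Lemma integral_joint (g : X * Y -> R) : P.-integrable setT (EFin \o g) ->
  (\int[P]_z (g z)%:E = \int[Q]_x \int[K x]_y (g (x, y))%:E)%E.
Proof.
move=> ig; have mg := measurable_int _ ig.
have [mp Ep] := disintegration_joint Q K (measurable_funepos mg) (funepos_ge0 _).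
have [mn En] := disintegration_joint Q K (measurable_funeneg mg) (funeneg_ge0 _).
have Ip x : (0 <= \int[K x]_y (EFin \o g)^\+ (x, y))%E by exact: integral_ge0.
have In x : (0 <= \int[K x]_y (EFin \o g)^\- (x, y))%E by exact: integral_ge0.
have /integrableP[_ lp] := integrable_funepos measurableT ig.
have /integrableP[_ ln] := integrable_funeneg measurableT ig.
rewrite integralE Ep En -integralB//.
- by apply: eq_integral => x _; rewrite integral_fiber_funeposneg.
- apply/integrableP; split => //; under eq_integral do rewrite gee0_abs//.
  by rewrite -Ep; apply: le_lt_trans lp; apply: ge0_le_integral => //;
    [exact: measurable_funepos|apply: measurableT_comp => //; exact: measurable_funepos
    |move=> z _; exact: lee_abs].
- apply/integrableP; split => //; under eq_integral do rewrite gee0_abs//.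
  by rewrite -En; apply: le_lt_trans ln; apply: ge0_le_integral => //;
    [exact: measurable_funeneg|apply: measurableT_comp => //; exact: measurable_funeneg
    |move=> z _; exact: lee_abs].
Qed.

Variable s : X * Y -> R.
Hypothesis ss : square_integrable P s.
Local Notation S := (fun z : X * Y => cond_mean K s z.1).

Lemma square_integrable_cst d (T : measurableType d)
  (mu : {measure set T -> \bar R}) (c : R) : (mu setT < +oo)%E ->
  square_integrable mu (fun=> c).
Proof.
by move=> mu_fin; split => //; rewrite integral_cst// lte_mul_pinfty ?lee_fin ?sqr_ge0.
Qed.

Lemma ae_square_integrable_fiber :
  {ae Q, forall x, square_integrable (K x) (fun y => s (x, y))}.
Proof.
have [ms s2] := ss.
have ms2 : measurable_fun setT (fun z => (s z ^+ 2)%:E).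
  by apply/measurable_EFinP; exact: measurable_funX.
have s20 z : (0 <= (s z ^+ 2)%:E)%E by rewrite lee_fin sqr_ge0.
have [mI IE] := disintegration_joint Q K ms2 s20.
have : {ae Q, forall x, setT x -> (\int[K x]_y (s (x, y) ^+ 2)%:E)%E \is a fin_num}.
  apply: integrable_ae => //; apply/integrableP; split => //.
  under eq_integral do rewrite gee0_abs ?integral_ge0//.
  by rewrite -IE.
apply: filterS => x /(_ I) fx; split; first exact: measurable_fun_pairl.
by rewrite ltey_eq fx.
Qed.

(** Jensen's inequality in almost every fibre, in the form of Cauchy-Schwarz against the constant
    1. *)
Lemma square_integrable_cond_mean : square_integrable P S.
Proof.
have [ms s2] := ss.
have mS : measurable_fun setT (cond_mean K s) by exact: measurable_cond_mean.
split; first exact: measurable_fun_fst.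
have ms2 : measurable_fun setT (fun z => (s z ^+ 2)%:E).
  by apply/measurable_EFinP; exact: measurable_funX.
have s20 z : (0 <= (s z ^+ 2)%:E)%E by rewrite lee_fin sqr_ge0.
have [mI IE] := disintegration_joint Q K ms2 s20.
apply: le_lt_trans s2; rewrite IE ge0_integral_joint; last 2 first.
- by apply/measurable_EFinP; apply: measurable_funX; exact: measurable_fun_fst.
- by move=> z; rewrite lee_fin sqr_ge0.
rewrite /=; under eq_integral do rewrite integral_cst//= prob_kernel mule1.
apply: ae_ge0_le_integral => //.
- by move=> x _; rewrite lee_fin sqr_ge0.
- by apply/measurable_EFinP; exact: measurable_funX.
- by move=> x _; exact: integral_ge0.
apply: filterS ae_square_integrable_fiber => x sx _.
have s1 : square_integrable (K x) (fun=> 1).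
  by apply: square_integrable_cst; rewrite prob_kernel ltry.
rewrite -(EFin_inner sx) lee_fin.
have := inner_sqr_le sx s1.
have -> : inner (K x) (fun y => s (x, y)) (fun=> 1) = cond_mean K s x.
  by apply: eq_Rintegral => y _; rewrite mulr1.
suff -> : inner (K x) (fun=> 1) (fun=> 1) = 1 by rewrite mulr1.
by rewrite /inner Rintegral_cst// prob_kernel mulr1 mul1r.
Qed.

(** In a fibre [h] is constant and leaves the integral. This is the orthogonality of s - S to the
    square-integrable functions of the first coordinate. *)
Lemma inner_cond_mean (h : X -> R) : square_integrable P (fun z => h z.1) ->
  inner P s (fun z => h z.1) = inner P S (fun z => h z.1).
Proof.
move=> sh; have sS := square_integrable_cond_mean.
rewrite /inner /Rintegral; congr fine.
rewrite !integral_joint; [|exact: square_integrableM..].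
have [ms _] := ss; have [mS _] := sS; have [mh _] := sh.
apply: ae_eq_integral => //.
- exact: (measurable_integral_fiber K (measurable_funM ms mh)).
- exact: (measurable_integral_fiber K (measurable_funM mS mh)).
apply: filterS ae_square_integrable_fiber => x sx _ /=.
have s1 : square_integrable (K x) (fun=> 1).
  by apply: square_integrable_cst; rewrite prob_kernel ltry.
have isx : (K x).-integrable setT (EFin \o (fun y => s (x, y))).
  have := square_integrableM sx s1.
  by congr (_.-integrable _ _); apply/funext => y /=; rewrite mulr1.
rewrite integral_cst//= prob_kernel mule1.
under eq_integral do rewrite EFinM muleC.
rewrite integralZl// EFinM muleC; congr (_ * _)%E.
by rewrite /cond_mean /Rintegral fineK//; exact: integrable_fin_num isx.
Qed.

End cond_mean_theory.

(** * Efficient influence functions *)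

Section square_integrable_Lfun.
Context d (T : measurableType d) (R : realType) (mu : {measure set T -> \bar R}).
Implicit Types f : T -> R.

Let Lnorm2_sqr f : ('N[mu]_2%:E[EFin \o f] `^ 2 = \int[mu]_x ((f x) ^+ 2)%:E)%E.
Proof.
rewrite poweR_Lnorm//; apply: eq_integral => x _.
by rewrite /= ?poweR_EFin powR_mulrn// real_normK// num_real.
Qed.

Lemma Lfun2P f : f \in Lfun mu 2%:E <-> square_integrable mu f.
Proof.
split=> [f2|[mf f2]].
- have /integrableP[_] := Lfun2_integrable_sqr f2.
  under eq_integral do rewrite gee0_abs ?lee_fin ?sqr_ge0//.
  by move=> ?; split => //; move: f2; rewrite inE => /andP[/[!inE]].
- rewrite inE; apply/andP; split; rewrite inE//= /finite_norm.
  rewrite ltey; apply/eqP => N2.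
  by move: f2; rewrite -Lnorm2_sqr N2 poweRyr// ltxx.
Qed.

Lemma Lnorm2_lt f e : square_integrable mu f -> 0 < e ->
  ('N[mu]_2%:E[EFin \o f] < e%:E)%E <-> inner mu f f < e ^+ 2.
Proof.
move=> sf e0; have /Lfun2P := sf; rewrite inE => /andP[_]; rewrite inE/= /finite_norm => Nfin.
have := Lnorm2_sqr f; rewrite -(EFin_inner sf).
have N0 := @Lnorm_ge0 _ _ _ mu 2%:E (EFin \o f).
move: Nfin N0; case: ('N[mu]_2%:E[EFin \o f])%E => // n _.
rewrite lee_fin => n0; rewrite poweR_EFin powR_mulrn// => -[<-].
by rewrite lte_fin ltr_pXn2r// nnegrE// ltW.
Qed.

Lemma square_integrable_sum n (c : 'I_n -> R) (f : 'I_n -> T -> R) :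
  (forall i, square_integrable mu (f i)) ->
  square_integrable mu (fun x => \sum_(i < n) c i * f i x).
Proof.
elim: n c f => [|n IH] c f sf.
  under [X in square_integrable _ X]eq_fun do rewrite big_ord0.
  split => //; rewrite (_ : (fun x => _) = cst 0%E) ?integral0//.
  by apply/funext => x; rewrite expr0n.
under [X in square_integrable _ X]eq_fun do rewrite big_ord_recr /=.
apply: square_integrableD; last exact: square_integrableZ.
by apply: (IH (fun i => c (widen_ord (leqnSn n) i)) (fun i => f (widen_ord (leqnSn n) i))).
Qed.

Lemma inner_sumr n (c : 'I_n -> R) (f : 'I_n -> T -> R) g :
  (forall i, square_integrable mu (f i)) -> square_integrable mu g ->
  inner mu g (fun x => \sum_(i < n) c i * f i x) = \sum_(i < n) c i * inner mu g (f i).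
Proof.
move=> sf sg; elim: n c f sf => [|n IH] c f sf.
  rewrite big_ord0 /inner (_ : (fun x => _) = fun=> 0) ?Rintegral_cst ?mul0r//.
  by apply/funext => x; rewrite big_ord0 mulr0.
rewrite big_ord_recr/= -IH// -innerZr// -innerDr//.
- by congr (inner _ _ _); apply/funext => x; rewrite big_ord_recr.
- exact: square_integrable_sum.
- exact: square_integrableZ.
Qed.

End square_integrable_Lfun.

Section closed_linear_span.
Context d (T : measurableType d) (R : realType) (P : probability T R).

Lemma expectation_mul_inner (f g : T -> R) : fine 'E_P[fun z => f z * g z] = inner P f g.
Proof. by rewrite unlock. Qed.

(** [inner P u g] is unchanged when an approximation of [g] from the span is subtracted, so
    Cauchy-Schwarz bounds it by the residual. The tolerance makes the squared bound at most [e], and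
    the 1 added in its denominator covers u = 0. *)
Lemma closed_linear_span_orthogonal (S : set (T -> R)) (u g : T -> R) :
  square_integrable P u ->
  (forall s, S s -> square_integrable P s /\ inner P u s = 0) ->
  closed_linear_span P S g -> inner P u g = 0.
Proof.
move=> su uS [/Lfun2P sg app].
apply/eqP; rewrite -sqrf_eq0 eq_le sqr_ge0 andbT; apply/ler_addgt0Pl => e e0.
rewrite addr0.
have u0 := inner_ge0 P u.
have d0 : 0 < e / (inner P u u + 1) by rewrite divr_gt0// ltr_wpDl.
have s0 : 0 < Num.sqrt (e / (inner P u u + 1)) by rewrite sqrtr_gt0.
have [n [c [s [sS lt]]]] := app _ s0.
have ss i : square_integrable P (s i) by have [] := uS _ (sS i).
have sG := square_integrable_sum c ss.
have sr := square_integrableB sg sG.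
have {}lt := (Lnorm2_lt sr s0).1 lt.
have -> : inner P u g = inner P u (fun z => g z - \sum_(i < n) c i * s i z).
  rewrite innerBr// inner_sumr// big1 ?subr0// => i _.
  by have [_ ->] := uS _ (sS i); rewrite mulr0.
apply: (le_trans (inner_sqr_le su sr)).
move: lt; rewrite sqr_sqrtr ?(ltW d0)// => lt.
apply: (@le_trans _ _ (inner P u u * (e / (inner P u u + 1)))).
  by rewrite ler_wpM2l// ltW.
rewrite mulrCA ler_piMr ?(ltW e0)//.
by rewrite ler_pdivrMr ?ltr_wpDl// mul1r lerDl.
Qed.

End closed_linear_span.

Section efficient_influence_function_theory.
Context d (Z : measurableType d) (R : realType).
Variables (nu : {sigma_finite_measure set Z -> \bar R}) (p : nat).
Variables (theta : probability Z R -> 'cV[R]_p) (P : probability Z R).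
Implicit Types (M : set (probability Z R)) (D : Z -> 'cV[R]_p).

Lemma score_square_integrable M s : score nu M P s -> square_integrable P s.
Proof. by move=> [T [t0 [Pt [_ _ _ [/Lfun2P]]]]]. Qed.

Lemma gradient_square_integrable M D i : gradient nu M theta P D ->
  square_integrable P (fun z => D z i 0).
Proof. by move=> [/(_ i)[/Lfun2P]]. Qed.

Lemma gradient_subset M M' D : M' `<=` M ->
  gradient nu M theta P D -> gradient nu M' theta P D.
Proof.
move=> sub [D2 gD]; split => // T t0 Pt s [T0 MT Pt0 s2 dqm].
by apply: (gD T t0 Pt s); split => // t /MT; exact: sub.
Qed.

Lemma gradient_inner_score M D D' i s : gradient nu M theta P D ->
  gradient nu M theta P D' -> score nu M P s ->
  inner P (fun z => D z i 0) s = inner P (fun z => D' z i 0) s.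
Proof.
move=> [_ gD] [_ gD'] [T [t0 [Pt sm]]].
have [_ h1] := gD _ _ _ _ sm; have [_ h2] := gD' _ _ _ _ sm.
have := etrans (esym h1) h2 => /(congr1 (fun v : 'cV[R]_p => v i 0)).
by rewrite !mxE !expectation_mul_inner.
Qed.

Lemma efficient_influence_function_coord M D i :
  efficient_influence_function nu M theta P D ->
  tangent_space nu M P (fun z => D z i 0).
Proof.
move=> [_ /(_ (delta_mx i 0))]; congr (tangent_space _ _ _ _).
by apply/funext => z; rewrite trmx_delta -rowE mxE.
Qed.

Lemma variance_matrix_inner D : (forall i, L20 P (fun z => D z i 0)) ->
  variance_matrix P D = \matrix_(i, j) inner P (fun z => D z i 0) (fun z => D z j 0).
Proof.
move=> D0; apply/matrixP => i j; rewrite !mxE covariance.unlock.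
have [_ ->] := D0 i; have [_ ->] := D0 j; rewrite -expectation_mul_inner.
by congr (fine 'E_P[_])%E; apply/funext => z;
  rewrite -[LHS]/((D z i 0 - 0) * (D z j 0 - 0)) !subr0.
Qed.

Lemma efficiency_lower_bound_unique M V V' :
  efficiency_lower_bound nu M theta P V ->
  efficiency_lower_bound nu M theta P V' -> V = V'.
Proof.
move=> [D [gD tD] ->] [D' [gD' tD'] ->].
have [D0 _] := gD; have [D'0 _] := gD'.
rewrite !variance_matrix_inner//; apply/matrixP => i j; rewrite !mxE.
have E k g : tangent_space nu M P g ->
    inner P (fun z => D z k 0) g = inner P (fun z => D' z k 0) g.
  move=> tg; have [/Lfun2P sg _] := tg.
  have sD := gradient_square_integrable k gD; have sD' := gradient_square_integrable k gD'.
  apply/eqP; rewrite -subr_eq0 -innerBl//; apply/eqP.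
  apply: (closed_linear_span_orthogonal _ _ tg); first exact: square_integrableB.
  move=> s Ms; have ss := score_square_integrable Ms; split => //.
  by rewrite innerBl// (gradient_inner_score k gD gD' Ms) subrr.
(* The slots of the inner product are exchanged one at a time: coordinate j of [D] is tangent, which
   allows the first exchange, and coordinate i of [D'] is tangent, which allows the second. *)
rewrite (E i); last by exact: efficient_influence_function_coord (conj gD tD).
rewrite innerC (E j) 1?innerC//.
exact: efficient_influence_function_coord (conj gD' tD').
Qed.

End efficient_influence_function_theory.

(** * Passage to the reduced model *)

Section reduced_model.
Context (dX dY : measure_display) (X : measurableType dX) (Y : measurableType dY)
  (R : realType).
Variables (PX : set (probability X R)) (PYX : set (R.-pker X ~> Y)).
Variable nu : {sigma_finite_measure set (X * Y)%type -> \bar R}.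
Hypothesis dominated : forall P, product_model PX PYX P -> P `<< nu.
Variables (Q0 : probability X R) (K0 : R.-pker X ~> Y).
Hypotheses (Q0_in : PX Q0) (K0_in : PYX K0).
Local Notation P0 := (joint Q0 K0 : probability (X * Y)%type R).
Local Notation M := (product_model PX PYX).
Local Notation M0 := (product_model [set Q0] PYX).

Lemma product_model_joint Q K : PX Q -> PYX K ->
  M (joint Q K : probability (X * Y)%type R).
Proof. by move=> ? ?; exists Q, K. Qed.

Lemma reduced_model_subset : M0 `<=` M.
Proof. by move=> _ [Q [K [-> ? ->]]]; exact: product_model_joint. Qed.

Lemma L20_cond_mean s : L20 P0 s -> L20 P0 (fun z => cond_mean K0 s z.1) /\
  L20 P0 (fun z => s z - cond_mean K0 s z.1).
Proof.
move=> [/Lfun2P ss Es].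
have sS := square_integrable_cond_mean ss.
have sD := square_integrableB ss sS.
have s1 : square_integrable P0 (fun=> 1).
  by apply: square_integrable_cst; rewrite ltey_eq fin_num_measure.
have EE f : square_integrable P0 f -> ('E_P0[f] = (inner P0 f (fun=> 1))%:E)%E.
  move=> sf; have := square_integrableM sf s1.
  move=> /(integrable_fin_num measurableT) fin.
  rewrite /inner /Rintegral fineK// expectation.unlock.
  by apply: eq_integral => z _; rewrite mulr1.
have E0 : inner P0 s (fun=> 1) = 0 by move: Es; rewrite EE// => -[].
have ES : inner P0 (fun z => cond_mean K0 s z.1) (fun=> 1) = 0.
  by rewrite -E0; apply/esym; exact: (@inner_cond_mean _ _ _ _ _ _ _ _ ss (fun=> 1)).
split; split.
- exact/Lfun2P.
- by rewrite EE// ES.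
- exact/Lfun2P.
- by rewrite EE// innerBl// E0 ES subrr.
Qed.

Lemma regular_submodel_factors T t0 Pt s : regular_submodel nu M P0 T t0 Pt s ->
  exists2 Qt : R -> probability X R, forall t, T t -> PX (Qt t) &
  regular_submodel nu M P0 T t0 (fun t => joint (Qt t) K0)
    (fun z => cond_mean K0 s z.1) /\
  score nu M0 P0 (fun z => s z - cond_mean K0 s z.1).
Proof.
move=> [nT MT Pt0 Ls dqm].
(* A joint law need not determine its kernel, so a factorisation is chosen at each t and forced at
   [t0] to be [(Q0, K0)], the pair in which well-specification and the reduced model are expressed.
   Outside [T] the choice is arbitrary. *)
have /choice[F HF] : forall t, exists FK : probability X R * (R.-pker X ~> Y),
    (T t -> [/\ PX FK.1, PYX FK.2 &
                Pt t = joint FK.1 FK.2 :> probability (X * Y)%type R]) /\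
    (t = t0 -> FK = (Q0, K0)).
  move=> t; have [->|tt0] := eqVneq t t0; first by exists (Q0, K0).
  have [Tt|nTt] := pselect (T t).
    have [Q [K [PXQ PYXK PtE]]] := MT t Tt.
    by exists (Q, K); split => // E; rewrite E eqxx in tt0.
  by exists (Q0, K0).
have F0 : F t0 = (Q0, K0) by have [_ /(_ erefl)] := HF t0.
have FT t : T t -> [/\ PX (F t).1, PYX (F t).2 &
               Pt t = joint (F t).1 (F t).2 :> probability (X * Y)%type R].
  by have [] := HF t.
have [LS LD] := L20_cond_mean Ls.
have ss : square_integrable (joint (F t0).1 (F t0).2) s.
  by rewrite F0; case: Ls => /Lfun2P.
have [||dqmS dqmD] := @dqm_factors _ _ _ _ _ nu (fun t => (F t).1) (fun t => (F t).2)
  Pt t0 T s nT _ _ ss dqm.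
- by move=> t /FT[].
(* The mixed laws are dominated because the model contains every combination of its marginals and
   kernels. *)
- by move=> t /FT[FX FY _]; rewrite F0; split; apply: dominated;
    exact: product_model_joint.
rewrite F0 /= in dqmS dqmD.
exists (fun t => (F t).1); first by move=> t /FT[].
split.
  split.
  - exact: nT.
  - by move=> t /FT[FX _ _]; exact: product_model_joint.
  - by rewrite F0.
  - exact: LS.
  - exact: dqmS.
exists T, t0, (fun t => joint Q0 (F t).2 : probability (X * Y)%type R).
split.
- exact: nT.
- by move=> t /FT[_ FY _]; exists Q0, (F t).2.
- by rewrite F0.
- exact: LD.
- exact: dqmD.
Qed.

Variables (p : nat) (theta : probability (X * Y)%type R -> 'cV[R]_p).
Hypothesis theta_ws : well_specified theta PX Q0 K0.

Lemma gradient_inner_cond_mean D s i : gradient nu M theta P0 D -> score nu M P0 s ->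
  inner P0 (fun z => D z i 0) (fun z => cond_mean K0 s z.1) = 0.
Proof.
move=> [_ gD] [T [t0 [Pt sm]]].
have [Qt QtX [smS _]] := regular_submodel_factors sm.
have dD := gD _ _ _ _ smS; have [nT _ _ _ _] := smS.
have near_cst : \forall t \near t0, cst (theta P0) t = theta (joint (Qt t) K0).
  by apply: filterS nT => t Tt; apply: theta_ws; exact: QtX.
have [_ d0] := near_eq_is_derive near_cst (is_derive_cst (theta P0) t0 1).
have [_ d1] := dD.
have := etrans (esym d1) d0 => /(congr1 (fun v : 'cV[R]_p => v i 0)).
by rewrite !mxE expectation_mul_inner.
Qed.

Lemma efficient_influence_function_reduced D :
  efficient_influence_function nu M theta P0 D ->
  efficient_influence_function nu M0 theta P0 D.
Proof.
move=> [gD tD]; split; first exact: gradient_subset reduced_model_subset gD.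
move=> a; have [sf app] := tD a; split; first exact: sf.
move=> e e0.
have sD i := gradient_square_integrable i gD.
have fE : (fun z => (a^T *m D z) 0 0) = (fun z => \sum_(i < p) a i 0 * D z i 0).
  by apply/funext => z; rewrite mxE; apply: eq_bigr => i _; rewrite mxE.
move: sf => /Lfun2P sf.
rewrite fE in sf.
set f := (fun z => _) in sf fE.
have fz z : (a^T *m D z) 0 0 = f z by rewrite -[LHS]/((fun z => (a^T *m D z) 0 0) z) fE.
have [n [c [s [sM]]]] := app e e0; rewrite (_ : (fun z => _) =
  fun z => f z - \sum_(i < n) c i * s i z)%R; last first.
  by apply/funext => z; rewrite fz.
move=> lt.
have ss i := score_square_integrable (sM i).
pose S i (z : X * Y) := cond_mean K0 (s i) z.1.
have sS i : square_integrable P0 (S i) by exact: square_integrable_cond_mean (ss i).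
have sB i : square_integrable P0 (fun z => s i z - S i z) by exact: square_integrableB.
exists n, c, (fun i z => s i z - S i z); split.
  move=> i; have [T [t0 [Pt sm]]] := sM i.
  by have [Qt _ [_ smD]] := regular_submodel_factors sm; exact: smD.
have sG := square_integrable_sum c ss.
have sGS := square_integrable_sum c sS.
have sGB := square_integrable_sum c sB.
have fS j : inner P0 f (S j) = 0.
  rewrite /f innerC inner_sumr// big1// => i _.
  by rewrite innerC (gradient_inner_cond_mean i gD (sM j)) mulr0.
have BS i j : inner P0 (fun z => s i z - S i z) (S j) = 0.
  by rewrite innerBl// (inner_cond_mean (ss i) (sS j)) subrr.
have sfB := square_integrableB sf sGB.
(* By [fS] and [BS] the new residual is orthogonal to the combination of the conditional means. The
   old residual is the new one minus that combination, so by Pythagoras its norm is at least as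
   large. *)
have orth : inner P0 (fun z => f z - \sum_(i < n) c i * (s i z - S i z))
    (fun z => \sum_(i < n) c i * S i z) = 0.
  rewrite inner_sumr// big1// => j _; rewrite innerBl// fS sub0r.
  by rewrite innerC inner_sumr// big1 ?oppr0 ?mulr0// => i _; rewrite innerC BS mulr0.
rewrite (_ : _ \o _ = EFin \o (fun z => f z - \sum_(i < n) c i * (s i z - S i z))); last first.
  by apply/funext => z /=; rewrite fz.
apply/(Lnorm2_lt sfB e0).
have := (Lnorm2_lt (square_integrableB sf sG) e0).1 lt.
apply: le_lt_trans.
rewrite (_ : (fun z => f z - \sum_(i < n) c i * s i z) = (fun z =>
   (f z - \sum_(i < n) c i * (s i z - S i z)) - \sum_(i < n) c i * S i z)); last first.
  apply/funext => z; rewrite -addrA -opprD -big_split/=; congr (_ - _).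
  by apply: eq_bigr => i _; rewrite -mulrDr subrK.
have sD2 := square_integrableB sfB sGS.
rewrite (innerBl sfB sGS sD2) (innerBr sfB sGS sfB) (innerBr sfB sGS sGS).
rewrite [inner _ (fun z => \sum_(i < n) c i * S i z) (fun z => f z - _)]innerC orth.
by rewrite subr0 sub0r opprK lerDl inner_ge0.
Qed.

End reduced_model.

(** Since [efficiency_lower_bound] is a relation, equality of the two bounds takes the form of one
    matrix that is the [unique] solution in either model. *)
Theorem corollary3p3 (R : realType) (dX dY : measure_display)
  (X : measurableType dX) (Y : measurableType dY)
  (PX : set (probability X R)) (PYX : set (R.-pker X ~> Y))
  (nu : {sigma_finite_measure set (X * Y)%type -> \bar R})
  (dominated : forall P, product_model PX PYX P -> P `<< nu)
  (PXstar : probability X R) (PXstar_in : PX PXstar)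
  (PYXstar : R.-pker X ~> Y) (PYXstar_in : PYX PYXstar)
  (Pstar : probability (X * Y)%type R)
  (PstarE : Pstar = joint PXstar PYXstar :> probability (X * Y)%type R)
  (p : nat) (Theta : set 'cV[R]_p)
  (theta : probability (X * Y)%type R -> 'cV[R]_p)
  (theta_in : forall P, product_model PX PYX P -> Theta (theta P))
  (Omega : metricType R) (eta : probability (X * Y)%type R -> Omega)
  (phi : Omega -> X * Y -> 'cV[R]_p)
  (phi_eif : efficient_influence_function nu (product_model PX PYX) theta Pstar
               (phi (eta Pstar)))
  (theta_ws : well_specified theta PX PXstar PYXstar) :
  exists V : 'M[R]_p,
    unique (efficiency_lower_bound nu (product_model PX PYX) theta Pstar) V /\
    unique (efficiency_lower_bound nu (product_model [set PXstar] PYX)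
              theta Pstar) V.
Proof.
subst Pstar; set D := phi _ in phi_eif.
have eif0 := efficient_influence_function_reduced dominated PXstar_in PYXstar_in
  theta_ws phi_eif.
exists (variance_matrix (joint PXstar PYXstar) D); split; split.
- by exists D.
- by move=> V; apply: efficiency_lower_bound_unique; exists D.
- by exists D.
- by move=> V; apply: efficiency_lower_bound_unique; exists D.
Qed.
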